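(* Let $H$ be a real Hilbert space, let $-\infty<T_0<T<+\infty$, and let $C(\cdot)$, $f_1$, $f_2$ satisfy $(\mathcal H_1)$, $(\mathcal H_2)$, $(\mathcal H_3)$ and $(\mathcal H'_{3,1})$ (all written out in the context). For each $a\in C(T_0)$ denote by $x_a(\cdot)$ the unique absolutely continuous solution of $$-\dot x(t)\in N_{C(t)}(x(t))+f_1(t,x(t))+\int_{T_0}^{t}f_2(t,s,x(s))\,ds\quad\text{a.e. in }[T_0,T],\qquad x(T_0)=a .$$ Then the map $\psi:a\mapsto x_a(\cdot)$ from $C(T_0)$ to the space $\mathcal C([T_0,T],H)$ of continuous mappings endowed with the uniform convergence norm is Lipschitz on any bounded subset of $C(T_0)$.
   Context: $H$ is a real Hilbert space with inner product $\langle\cdot,\cdot\rangle$ and norm $\|\cdot\|$; $\mathbb B_H$ is its closed unit ball; $B[0,\eta]$ is the closed ball of radius $\eta$ centered at $0$; $Q_\Delta:=\{(t,s)\in[T_0,T]\times[T_0,T]: s\le t\}$. Normal cones and prox-regularity. For a subset $S\subset H$ and $x\in S$, the Clarke tangent cone $T^C(S;x)$ is the set of $h\in H$ such that for every sequence $(x_n)$ in $S$ with $x_n\to x$ and every sequence $t_n>0$ with $t_n\to0$ there is a sequence $h_n\to h$ in $H$ with $x_n+t_nh_n\in S$ for all $n$. The Clarke normal cone is $N_S(x):=\{v\in H:\langle v,h\rangle\le0\ \forall h\in T^C(S;x)\}$ for $x\in S$, and $N_S(x):=\emptyset$ for $x\notin S$. The proximal normal cone $N^P_S(x)$ at $x\in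 S$ is the set of $v\in H$ for which there are $\sigma\ge0$, $\delta>0$ with $\langle v,y-x\rangle\le\sigma\|y-x\|^2$ for all $y\in S$ with $\|y-x\|<\delta$. For $r\in(0,+\infty]$, a closed set $S$ is $r$-prox-regular if for all $x\in S$ and all $0\ne\zeta\in N^P_S(x)$ one has $\langle\zeta/\|\zeta\|,y-x\rangle\le\frac{1}{2r}\|y-x\|^2$ for all $y\in S$ (with $1/r=0$ if $r=+\infty$). For such sets the Clarke and proximal normal cones coincide. A solution is an absolutely continuous map $x:[T_0,T]\to H$ with the prescribed initial value satisfying the inclusion for a.e. $t$. Under the assumptions below such a solution exists and is unique for every $a\in C(T_0)$. Assumptions. $(\mathcal H_1)$: there is $r\in(0,+\infty]$ such that for each $t\in[T_0,T]$, $C(t)$ is a nonempty closed $r$-prox-regular subset of $H$; and there is an absolutely continuous function $\upsilon:[T_0,T]\to\mathbb R$ with $C(t)\subset C(s)+|\upsilon(s)-\upsilon(t)|\mathbb B_H$ for all $s,t\in[T_0,T]$. $(\mathcal H_2)$: $f_1:[T_0,T]\times H\to H$ is such that $f_1(\cdot,x)$ is Lebesgue measurable for each $x\in H$, and $(\mathcal H_{2,1})$ there is a non-negative $\beta_1\in L^1([T_0,T],\mathbb R)$ with $\|f_1(t,x)\|\le\beta_1(t)(1+\|x\|)$ for all $t\in[T_0,T]$ and all $x\in\bigcup_{t\in[T_0,T]}C(t)$; $(\mathcal H_{2,2})$ for each real $\eta>0$ there is a non-negative $L_1^\eta\in L^1([T_0,T],\mathbb R)$ with $\|f_1(t,x)-f_1(t,y)\|\le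 L_1^\eta(t)\|x-y\|$ for all $t\in[T_0,T]$ and $x,y\in B[0,\eta]$. $(\mathcal H_3)$: $f_2:Q_\Delta\times H\to H$ is a measurable mapping such that $(\mathcal H_{3,1})$ there is a non-negative $\beta_2\in L^1(Q_\Delta,\mathbb R)$ with $\|f_2(t,s,x)\|\le\beta_2(t,s)(1+\|x\|)$ for all $(t,s)\in Q_\Delta$ and all $x\in\bigcup_{t\in[T_0,T]}C(t)$; $(\mathcal H_{3,2})$ for each real $\eta>0$ there is a non-negative $L_2^\eta\in L^1([T_0,T],\mathbb R)$ with $\|f_2(t,s,x)-f_2(t,s,y)\|\le L_2^\eta(t)\|x-y\|$ for all $(t,s)\in Q_\Delta$ and $x,y\in B[0,\eta]$. $(\mathcal H'_{3,1})$ (strengthened form of $(\mathcal H_{3,1})$): there exist non-negative functions $\alpha\in L^1([T_0,T],\mathbb R)$ and $g\in L^1(Q_\Delta,\mathbb R)$ such that $\|f_2(t,s,x)\|\le g(t,s)+\alpha(t)\|x\|$ for all $(t,s)\in Q_\Delta$ and all $x\in\bigcup_{t\in[T_0,T]}C(t)$. *)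

(* Defs.v *)
From HB Require Import structures.
From mathcomp Require Import all_boot all_order all_algebra.
From mathcomp Require Import all_classical all_reals all_analysis.
From mathcomp Require Import measurable_realfun.

Set Implicit Arguments.
Unset Strict Implicit.
Unset Printing Implicit Defensive.

Import Order.TTheory GRing.Theory Num.Theory.
Import numFieldNormedType.Exports.

Local Open Scope classical_set_scope.
Local Open Scope ring_scope.

(* A real Hilbert space is a complete normed module [H] over [R : realType]
   together with an inner product [dot : {dot H for idfun}] (a symmetric
   positive definite bilinear form) that induces the norm. *)
Definition norm_of_dot (R : realType) (H : completeNormedModType R)
    (dot : {dot H for (@idfun R)}) : Prop :=
  forall x : H, `|x| ^+ 2 = dot x x.

Section NormalCones.
Context (R : realType) (H : completeNormedModType R).
Variable dot : {dot H for (@idfun R)}.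
Implicit Types (S : set H) (x y v h : H).

Definition clarke_tangent_cone S x : set H :=
  [set h | forall (xs : nat -> H) (ts : nat -> R),
    (forall n, S (xs n)) -> xs @ \oo --> x ->
    (forall n, 0 < ts n) -> ts @ \oo --> (0 : R) ->
    exists hs : nat -> H,
      hs @ \oo --> h /\ forall n, S (xs n + ts n *: hs n)].

Definition clarke_normal_cone S x : set H :=
  [set v | S x /\ forall h, clarke_tangent_cone S x h -> dot v h <= 0].

Definition proximal_normal_cone S x : set H :=
  [set v | S x /\ exists sigma delta : R, [/\ 0 <= sigma, 0 < delta &
    forall y, S y -> `|y - x| < delta ->
      dot v (y - x) <= sigma * `|y - x| ^+ 2]].

(* 1 / (2 r), with the convention 1 / (+oo) = 0 *)
Definition half_inve (r : \bar R) : R :=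
  if r is r'%:E then (2 * r')^-1 else 0.

Definition prox_regular (r : \bar R) S : Prop :=
  closed S /\
  forall x zeta, S x -> proximal_normal_cone S x zeta -> zeta != 0 ->
  forall y, S y ->
    dot (`|zeta|^-1 *: zeta) (y - x) <= half_inve r * `|y - x| ^+ 2.

End NormalCones.

Definition abs_continuous (R : realType) (V : normedModType R) (a b : R)
    (f : R -> V) : Prop :=
  forall e : R, 0 < e -> exists2 d : R, 0 < d &
    forall (n : nat) (u v : 'I_n -> R),
      (forall i, [/\ a <= u i, u i <= v i & v i <= b]) ->
      trivIset [set: 'I_n] (fun i => `]u i, v i[%classic) ->
      \sum_(i < n) (v i - u i) < d ->
      \sum_(i < n) `|f (v i) - f (u i)| < e.

Section LebesgueMeasurability.
Context d (T : measurableType d) (R : realType).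
Variable mu : {measure set T -> \bar R}.

(* [completed_algebra_gen mu] is the completion of the sigma-algebra of [T]
   under [mu]: for [mu] the Lebesgue measure on the Borel sets (of the line or
   of the plane), it consists of the Lebesgue measurable sets. *)
Definition completed_measurable_fun (V : topologicalType) (D : set T)
    (f : T -> V) : Prop :=
  forall U : set V, open U -> completed_algebra_gen mu (D `&` f @^-1` U).

(* The integral of a nonnegative function is the supremum of the integrals of
   the simple functions below it, so on functions that are measurable for the
   completed sigma-algebra it is the integral for the completion of [mu]. *)
Definition L1fun (D : set T) (f : T -> R) : Prop :=
  completed_measurable_fun D f /\
  (\int[mu]_(x in D) (`|f x|%:E) < +oo)%E.

Definition L1fun_ge0 (D : set T) (f : T -> R) : Prop :=
  L1fun D f /\ forall x, D x -> 0 <= f x.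

Section Bochner.
Variable H : normedModType R.

Definition integrable_simple (D : set T) (s : {fimfun T >-> H}) : Prop :=
  forall y, measurable (D `&` s @^-1` [set y]) /\
    (y != 0 -> (mu (D `&` s @^-1` [set y]) < +oo)%E).

Definition simple_integral (D : set T) (s : {fimfun T >-> H}) : H :=
  \sum_(y \in [set: H]) fine (mu (D `&` s @^-1` [set y])) *: y.

(* [f] is Bochner integrable over [D] and its Bochner integral is [w]. *)
Definition is_bochner_integral (D : set T) (f : T -> H) (w : H) : Prop :=
  exists s : nat -> {fimfun T >-> H},
    [/\ forall n, integrable_simple D (s n),
        {ae mu, forall x, D x -> s n x @[n --> \oo] --> f x},
        (\int[mu]_(x in D) (`|f x - s n x|%:E))%E @[n --> \oo] --> 0%E &
        simple_integral D (s n) @[n --> \oo] --> w].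

End Bochner.
End LebesgueMeasurability.

Section SweepingProcess.
Context (R : realType) (H : completeNormedModType R).
Variable dot : {dot H for (@idfun R)}.
Variables T0 T : R.

Let I : set R := `[T0, T]%classic.

Notation leb := (@lebesgue_measure R).
Notation leb2 := (@lebesgue_measure R \x @lebesgue_measure R)%E.

(* pairs (t, s) with T0 <= s <= t <= T *)
Definition Qdelta : set (R * R) :=
  [set p | [/\ I p.1, I p.2 & p.2 <= p.1]].

Variable C : R -> set H.
Variable f1 : R -> H -> H.
Variable f2 : R -> R -> H -> H.

Definition hypothesis_H1 : Prop :=
  (exists2 r : \bar R, (0 < r)%E &
    forall t, I t -> C t !=set0 /\ prox_regular dot r (C t)) /\
  (exists2 ups : R -> R, abs_continuous T0 T (ups : R -> R^o) &
    forall s t, I s -> I t ->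
      C t `<=` [set y + `|ups s - ups t| *: b |
                 y in C s & b in [set b : H | `|b| <= 1]]).

Definition hypothesis_H2 : Prop :=
  [/\ forall x, completed_measurable_fun leb I (f1 ^~ x),
      exists2 beta1 : R -> R, L1fun_ge0 leb I beta1 &
        forall t x, I t -> (\bigcup_(t in I) C t) x ->
          `|f1 t x| <= beta1 t * (1 + `|x|) &
      forall eta : R, 0 < eta ->
        exists2 L1 : R -> R, L1fun_ge0 leb I L1 &
          forall t x y, I t -> `|x| <= eta -> `|y| <= eta ->
            `|f1 t x - f1 t y| <= L1 t * `|x - y|].

(* Product of the Lebesgue sigma-algebra of the plane and the Borel
   sigma-algebra of [H]. *)
Definition lebesgue_borel : set (set ((R * R) * H)) :=
  <<s [set A `*` U | A in completed_algebra_gen leb2 &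
                     U in (@open H : set (set H))] >>.

Definition hypothesis_H3 : Prop :=
  [/\ forall U : set H, open U ->
        lebesgue_borel ((Qdelta `*` [set: H]) `&`
                        (fun p => f2 p.1.1 p.1.2 p.2) @^-1` U),
      exists2 beta2 : R * R -> R, L1fun_ge0 leb2 Qdelta beta2 &
        forall t s x, Qdelta (t, s) -> (\bigcup_(t in I) C t) x ->
          `|f2 t s x| <= beta2 (t, s) * (1 + `|x|) &
      forall eta : R, 0 < eta ->
        exists2 L2 : R -> R, L1fun_ge0 leb I L2 &
          forall t s x y, Qdelta (t, s) -> `|x| <= eta -> `|y| <= eta ->
            `|f2 t s x - f2 t s y| <= L2 t * `|x - y|].

Definition hypothesis_H31' : Prop :=
  exists (alpha : R -> R) (g : R * R -> R),
    [/\ L1fun_ge0 leb I alpha, L1fun_ge0 leb2 Qdelta g &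
        forall t s x, Qdelta (t, s) -> (\bigcup_(t in I) C t) x ->
          `|f2 t s x| <= g (t, s) + alpha t * `|x|].

(* The values of [x] outside [T0, T] are irrelevant. *)
Definition sweeping_solution (a : H) (x : R -> H) : Prop :=
  [/\ abs_continuous T0 T x,
      x T0 = a &
      {ae leb, forall t, I t ->
        derivable x t 1 /\
        exists2 w : H,
          is_bochner_integral leb `[T0, t]%classic
            (fun s => f2 t s (x s)) w &
          clarke_normal_cone dot (C t) (x t) (- 'D_1 x t - f1 t (x t) - w)}].

(* The norm of C([T0, T], H); being valued in the extended reals, it is +oo on
   maps that are not bounded on [T0, T]. *)
Definition uniform_norm (x : R -> H) : \bar R :=
  ereal_sup [set (`|x t|)%:E | t in I].

End SweepingProcess.

(* Main.v *)
Require Import Defs.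
From HB Require Import structures.
From mathcomp Require Import all_boot all_order all_algebra.
From mathcomp Require Import all_classical all_reals all_analysis.
From mathcomp Require Import measurable_realfun.
From mathcomp Require Import ring lra.

(* Clarke normals to a prox-regular set are proximal, hence the normal cones are
   hypomonotone: for two solutions x and y, the distance z = |x - y| grows at rate
   at most (|v| + |v'|) / (2r) z plus the increments of f1 and of the integral of
   f2, where v and v' are the normals selected along x and y. The normals are
   bounded by the variation of upsilon and by the perturbations, so that
     z(t) - z(s) <= (sup_[T0,t] z) (c |upsilon(t) - upsilon(s)| + (t - s) k(t))
                    + o(t - s)
   for almost every t and all s < t close to t, with c and k in L1 uniform over a
   bounded set of initial values thanks to an a priori bound of the same form.
   On an interval where the variation and the integral of k are small, the
   supremum of z at most doubles; finitely many such intervals cover [T0, T],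
   whence the Lipschitz constant 2^N. *)
Set Implicit Arguments.
Unset Strict Implicit.
Unset Printing Implicit Defensive.
Import Order.TTheory GRing.Theory Num.Theory.
Import numFieldNormedType.Exports.
Local Open Scope classical_set_scope.
Local Open Scope ring_scope.

(** * Clarke and proximal normals *)

(** The integral of [f2] carries memory, so an increment of [z] at [t] is controlled by the supremum
    of [z] on [[T0, t]] and not by [z t]; hence a maximum argument on short intervals closes the
    estimate. The increments of [upsilon] are never replaced by a derivative: they are summed as
    variation. All estimates look to the left of [t]. If [u] is the total perturbation, then
    [x s - x t] is close to [(t - s) (v + u)] for [s < t], so testing [v] against a point of [C t]
    near [x s] bounds [|v|^2] from above; from the right the sign would be the wrong one. Passing
    from such left estimates, valid almost everywhere, to a global one rests on the small variation
    of an absolutely continuous function inside an open set of small measure. For the normals, the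
    pivot is a tangency statement: a direction polar to all proximal normals is Clarke tangent. In
    infinite dimension nearest points may fail to exist, and bounded sequences of normals may have
    no norm limit. The first obstacle is met by perturbing the point to be projected, the second by
    nested closed convex sets. *)

Section InnerProduct.
Context {R : realType} {H : completeNormedModType R}.
Context {dot : {dot H for (@idfun R)}} (Hdot : norm_of_dot dot).
Implicit Types (u v w x y : H) (a : R).

Lemma dotC u v : dot u v = dot v u.
Proof. by rewrite hermC expr0 mul1r. Qed.

Lemma dotDl u v w : dot (u + v) w = dot u w + dot v w.
Proof. exact: linearDl. Qed.

Lemma dotNl u w : dot (- u) w = - dot u w.
Proof. exact: linearNl. Qed.

Lemma dotZl a u w : dot (a *: u) w = a * dot u w.
Proof. exact: linearZl_LR. Qed.

Lemma dotDr u v w : dot w (u + v) = dot w u + dot w v.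
Proof. exact: linearDr. Qed.

Lemma dotNr u w : dot w (- u) = - dot w u.
Proof. exact: linearNr. Qed.

Lemma dotZr a u w : dot w (a *: u) = a * dot w u.
Proof. by rewrite dotC dotZl dotC. Qed.

Lemma dot0l u : dot 0 u = 0.
Proof. exact: linear0l. Qed.

Lemma dot0r u : dot u 0 = 0.
Proof. by rewrite dotC dot0l. Qed.

Definition dotE := (dotDl, dotDr, dotNl, dotNr, dotZl, dotZr).

Lemma sqr_normD u v : `|u + v| ^+ 2 = `|u| ^+ 2 + 2 * dot u v + `|v| ^+ 2.
Proof. rewrite !Hdot !dotE (dotC v u); ring. Qed.

Lemma sqr_normB u v : `|u - v| ^+ 2 = `|u| ^+ 2 - 2 * dot u v + `|v| ^+ 2.
Proof. by rewrite sqr_normD dotNr normrN mulrN. Qed.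

(** Cauchy-Schwarz, from expanding the squared norm of [|v| u - |u| v]. *)
Lemma dot_le_norm u v : dot u v <= `|u| * `|v|.
Proof.
have [->|v0] := eqVneq v 0; first by rewrite normr0 mulr0 dotC dot0l.
have pv : 0 < `|v| by rewrite normr_gt0.
have := sqr_ge0 `| `|v| *: u - `|u| *: v|.
rewrite sqr_normB !normrZ !normr_id !dotE.
rewrite (_ : _ + _ = 2 * `|u| * `|v| * (`|u| * `|v| - dot u v)); last by ring.
have [->|u0] := eqVneq u 0; first by rewrite dot0l normr0 mul0r.
have pu : 0 < `|u| by rewrite normr_gt0.
by rewrite pmulr_rge0 ?mulr_gt0 // subr_ge0.
Qed.

Lemma normr_dot_le u v : `|dot u v| <= `|u| * `|v|.
Proof.
rewrite ler_norml dot_le_norm andbT lerNl -dotNl.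
by rewrite -(normrN u) dot_le_norm.
Qed.

Lemma cvg_dotr u (F : set_system H) {FF : Filter F} w :
  F --> w -> dot u y @[y --> F] --> dot u w.
Proof.
move=> Fw; apply/cvgrPdist_le => e e0.
have d0 : 0 < e / (`|u| + 1) by rewrite divr_gt0 // ltr_wpDl.
move/cvgrPdist_le: Fw => /(_ _ d0); apply: filterS => y hy.
rewrite -dotNr -dotDr (le_trans (normr_dot_le _ _)) //.
have u1 : 0 < `|u| + 1 by rewrite ltr_wpDl.
move: hy; rewrite ler_pdivlMr // => hy; apply: le_trans hy.
by rewrite mulrC ler_wpM2l // lerDl.
Qed.

End InnerProduct.

(** * Projections and nearest points in a Hilbert space *)

Section Nearest.
Context (R : realType) (H : completeNormedModType R).
Context (dot : {dot H for (@idfun R)}) (Hdot : norm_of_dot dot).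
Implicit Types (S K : set H) (x y u v w : H).

Lemma cvgn_of_tail_bound (s : nat -> H) (e : nat -> R) :
  e @ \oo --> (0 : R) -> (forall m n, (m <= n)%N -> `|s n - s m| <= e m) ->
  cvgn s.
Proof.
move=> e0 hs; apply/cauchy_cvgP/cauchy_exP => d d0.
move/cvgrPdist_lt: e0 => /(_ _ d0)[N _ hN].
exists (s N); exists N => // n /= Nn; rewrite -ball_normE /= distrC.
apply: (le_lt_trans (hs _ _ Nn)); have := hN _ (leqnn N).
by rewrite /= sub0r normrN; apply: le_lt_trans; exact: ler_norm.
Qed.

Definition midpoint_closed K := forall x y, K x -> K y -> K (2^-1 *: (x + y)).

(* Elements of almost minimal norm form a Cauchy sequence by the parallelogram
   identity; this replaces weak compactness. *)
Lemma nested_convex_meet (A : nat -> set H) (B : R) :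
  (forall n, closed (A n)) -> (forall n, midpoint_closed (A n)) ->
  (forall n, A n !=set0) -> (forall n, A n.+1 `<=` A n) ->
  (forall x, A 0%N x -> `|x| <= B) ->
  exists w, forall n, A n w.
Proof.
move=> clA mA neA dA bA.
have subA m n : (m <= n)%N -> A n `<=` A m.
  move=> /subnK <-; elim: (n - m)%N => [//|k ih]; rewrite addSn.
  by apply: subset_trans ih; exact: dA.
pose N n := [set `|x| ^+ 2 | x in A n].
have lbN n : has_inf (N n).
  split; first by have [x Ax] := neA n; exists (`|x| ^+ 2), x.
  by exists 0 => _ [x _ <-]; exact: sqr_ge0.
pose d n := inf (N n).
have dle n x : A n x -> d n <= `|x| ^+ 2.
  by move=> Ax; apply: ge_inf; [exact: (lbN n).2|exists x].
have dB n : d n <= B ^+ 2.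
  have [x Ax] := neA n; apply: (le_trans (dle _ _ Ax)).
  by rewrite lerXn2r ?nnegrE // ?bA //; [apply: le_trans (bA x _)|];
    rewrite //; exact: (subA 0%N n).
have dmono m n : (m <= n)%N -> d m <= d n.
  move=> mn; apply: lb_le_inf; first exact: (lbN n).1.
  by move=> _ [x Ax <-]; apply: dle; exact: subA Ax.
have cvd : cvgn d.
  apply: nondecreasing_is_cvgn; first by move=> m n; exact: dmono.
  by exists (B ^+ 2) => _ [n _ <-].
have /choice[w hw] : forall n, exists x, A n x /\ `|x| ^+ 2 < d n + n.+1%:R^-1.
  move=> n; have e0 : 0 < n.+1%:R^-1 :> R by rewrite invr_gt0.
  by have [_ [x Ax <-] h] := inf_adherent e0 (lbN n); exists x.
(* The midpoint of [w n] and [w m] lies in [A m], so its squared norm is at least [d m]; the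
   parallelogram identity turns this into a bound on the distance. *)
have key m n : (m <= n)%N ->
    `|w n - w m| ^+ 2 <= 2 * (d n - d m) + 4 * m.+1%:R^-1.
  move=> mn.
  have [Am hm] := hw m; have [An hn] := hw n.
  have := dle m _ (mA m _ _ (subA _ _ mn _ An) Am).
  rewrite normrZ exprMn (sqr_normB Hdot) (sqr_normD Hdot) => h.
  have : n.+1%:R^-1 <= m.+1%:R^-1 :> R by rewrite lef_pV2 ?posrE // ler_nat.
  move: h hm hn; rewrite ger0_norm ?invr_ge0 //.
  set a := `|w n| ^+ 2; set b := `|w m| ^+ 2; set p := dot _ _.
  set i := n.+1%:R^-1; set j := m.+1%:R^-1; move: a b p i j => a b p i j.
  have -> : (2^-1 : R) ^+ 2 = 4^-1 by rewrite exprVn -natrX.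
  lra.
have cw : cvgn w.
  pose e m : R := Num.sqrt (2 * (limn d - d m) + 4 * m.+1%:R^-1).
  apply: (@cvgn_of_tail_bound _ e).
    rewrite -[X in _ --> X]sqrtr0; apply: continuous_cvg.
      exact: sqrt_continuous.
    have -> : (0 : R) = 2 * (limn d - limn d) + 4 * 0 by lra.
    apply: cvgD; apply: cvgM; try exact: cvg_cst; last exact: cvg_harmonic.
    by apply: cvgB => //; exact: cvg_cst.
  move=> m n mn; rewrite -(@ler_sqr _ `|_|) ?nnegrE ?sqrtr_ge0 //.
  have ld k : d k <= limn d by apply: nondecreasing_cvgn_le.
  rewrite sqr_sqrtr; last by rewrite addr_ge0 // mulr_ge0 // subr_ge0 ld.
  apply: (le_trans (key _ _ mn)); rewrite lerD2r ler_pM2l // lerD2r.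
  exact: ld.
exists (limn w) => n.
apply: (closed_cvg (A n) (clA n) _ _ cw).
by exists n => // m /= nm; apply: (subA n m nm); exact: (hw m).1.
Qed.

(** Let [t] tend to 0. The range stops at 1 because [cone_projection] uses the factor [1 - t]. *)
Lemma le0_of_small_mul (a b : R) :
  (forall t, 0 < t -> t <= 1 -> a <= t * b) -> a <= 0.
Proof.
move=> h; rewrite leNgt; apply/negP => a0.
have b0 : 0 < b by apply: lt_le_trans a0 _; have := h 1; rewrite mul1r; apply.
have t0 : 0 < a / (2 * b + a) by apply: divr_gt0 => //; lra.
have t1 : a / (2 * b + a) <= 1 by rewrite ler_pdivrMr; lra.
have := h _ t0 t1; rewrite mulrAC ler_pdivlMr; last by lra.
nra.
Qed.

(** Moreau decomposition. The residual [v - p] is a common point of the nested sets of residuals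
    whose norm exceeds the infimum by at most [1 / (n + 1)]. Moving [p] to [p + t k] gives polarity;
    moving it to [(1 - t) p] gives the other half of orthogonality. *)
Lemma cone_projection K v : closed K -> K 0 ->
  (forall x y, K x -> K y -> K (x + y)) ->
  (forall a x, 0 <= a -> K x -> K (a *: x)) ->
  exists p, [/\ K p, dot (v - p) p = 0 & forall k, K k -> dot (v - p) k <= 0].
Proof.
move=> clK K0 KD KZ.
pose N := [set `|v - k| | k in K].
have iN : has_inf N.
  by split; [exists `|v - 0|, 0|exists 0 => _ [k _ <-]].
pose d := inf N.
pose A n := [set y | K (v - y)] `&` [set y | `|y| <= d + n.+1%:R^-1].
have [|n x y [Kx nx] [Ky ny]|n|n x [Kx nx]|x [_]|y Ay] :=
    @nested_convex_meet A (d + 1%:R^-1); last 1 first.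
- have Kp : K (v - y) by have [] := Ay 0%N.
  have yd : `|y| <= d.
    apply/ler_addgt0Pr => e e0.
    have [n _ hn] := near_infty_natSinv_lt (PosNum e0).
    have [_ /le_trans] := Ay n; apply.
    by rewrite lerD2l; apply: ltW; exact: (hn n (leqnn n)).
  have ymin k : K k -> `|y| ^+ 2 <= `|v - k| ^+ 2.
    move=> Kk; rewrite lerXn2r ?nnegrE //; apply: (le_trans yd).
    by apply: ge_inf; [exact: iN.2|exists k].
  have pol k : K k -> dot y k <= 0.
    move=> Kk; apply: (@le0_of_small_mul _ (`|k| ^+ 2)) => t t0 _.
    have := ymin _ (KD _ _ Kp (KZ _ _ (ltW t0) Kk)).
    rewrite (_ : v - (v - y + t *: k) = y - t *: k); last first.
      by rewrite opprD addrA subKr.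
    rewrite (sqr_normB Hdot) normrZ exprMn dotZr gtr0_norm //.
    by nra.
  exists (v - y); rewrite subKr; split => //.
  apply/eqP; rewrite eq_le pol //= -oppr_le0 -dotNr.
  apply: (@le0_of_small_mul _ (`|v - y| ^+ 2)) => t t0 t1.
  have := ymin _ (KZ (1 - t) _ _ Kp); rewrite subr_ge0 => /(_ t1).
  rewrite (_ : v - (1 - t) *: (v - y) = y + t *: (v - y)); last first.
    by rewrite scalerBl scale1r opprD opprK addrA subKr.
  rewrite (sqr_normD Hdot) normrZ exprMn dotZr dotNr gtr0_norm //.
  by nra.
- move=> n; apply: closedI.
    apply: (closed_comp _ clK) => y _; apply: cvgB => //; exact: cvg_cst.
  apply: (@closed_comp _ _ (fun y : H => `|y|) [set r | r <= d + n.+1%:R^-1]).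
    by move=> y _; exact: norm_continuous.
  exact: closed_le.
- split => /=.
    rewrite (_ : v - _ = 2^-1 *: ((v - x) + (v - y))).
      by apply: KZ; [rewrite invr_ge0|exact: KD].
    rewrite addrACA -opprD scalerBr; congr (_ - _).
    by rewrite -mulr2n -(scaler_nat 2 v) scalerA mulVf ?scale1r // pnatr_eq0.
  rewrite normrZ ger0_norm ?invr_ge0 // ler_pdivrMl //.
  apply: (le_trans (ler_normD _ _)); move: nx ny => /=.
  by move: n.+1%:R^-1 => e; lra.
- have e0 : 0 < n.+1%:R^-1 :> R by rewrite invr_gt0.
  have [_ [k Kk <-] hk] := inf_adherent e0 iN.
  by exists (v - k); split => /=; [rewrite subKr|exact: ltW].
- split => //=; apply: (le_trans nx); rewrite lerD2l lef_pV2 ?posrE //.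
  by rewrite ler_nat.
- by [].
Qed.

(** Staying at least as near as [s0] costs nothing: if the almost minimizer is farther than [s0],
    then [s0] is itself almost minimal. This keeps the sets in the iteration of [near_nearest]
    nested. *)
Lemma near_minimizer S u s0 (e : R) : S s0 -> 0 < e ->
  exists s, [/\ S s, `|u - s| <= `|u - s0| &
    forall y, S y -> `|u - s| ^+ 2 <= `|u - y| ^+ 2 + e].
Proof.
move=> Ss0 e0; pose N := [set `|u - y| ^+ 2 | y in S].
have iN : has_inf N.
  by split; [exists (`|u - s0| ^+ 2), s0|exists 0 => _ [y _ <-]; exact: sqr_ge0].
have hle y : S y -> inf N <= `|u - y| ^+ 2.
  by move=> Sy; apply: ge_inf; [exact: iN.2|exists y].
have [_ [s Ss <-] hs] := inf_adherent e0 iN.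
have [us|us] := leP `|u - s| `|u - s0|.
  exists s; split => // y Sy; apply: (le_trans (ltW hs)).
  by rewrite lerD2r hle.
exists s0; split => // y Sy; apply: le_trans (_ : `|u - s| ^+ 2 <= _).
  by rewrite lerXn2r ?nnegrE // ltW.
by apply: (le_trans (ltW hs)); rewrite lerD2r hle.
Qed.

(* Moving [u] towards an almost nearest point [s0] confines the points of [S]
   that are at least as near as [s0] to a small neighbourhood of [s0]. *)
Lemma lens_estimate (u s0 y : H) (l : R) : 0 <= l -> l < 1 ->
  `|u + l *: (s0 - u) - y| <= `|u + l *: (s0 - u) - s0| ->
  l * `|y - s0| ^+ 2 <= `|u - s0| ^+ 2 - `|u - y| ^+ 2.
Proof.
move=> l0 l1 h.
have : `|u + l *: (s0 - u) - y| ^+ 2 <= `|u + l *: (s0 - u) - s0| ^+ 2.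
  by rewrite lerXn2r ?nnegrE.
rewrite (_ : u + l *: (s0 - u) - s0 = (1 - l) *: (u - s0)); last first.
  by rewrite scalerBl scale1r -(opprB u s0) scalerN addrAC.
rewrite (_ : u + l *: (s0 - u) - y = (1 - l) *: (u - s0) - (y - s0)); last first.
  rewrite scalerBl scale1r -(opprB u s0) scalerN opprB.
  by rewrite [RHS]addrA (addrAC _ _ s0) subrK.
rewrite (_ : u - y = (u - s0) - (y - s0)); last by rewrite opprB addrA subrK.
move: (u - s0) (y - s0) => a b.
rewrite !(sqr_normB Hdot) normrZ exprMn dotZl ger0_norm; last by lra.
move=> h1.
have h2 : `|b| ^+ 2 <= 2 * (1 - l) * dot a b by lra.
have h3 : 0 <= `|b| ^+ 2 := sqr_ge0 _.
have h4 : 0 <= dot a b by nra.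
nra.
Qed.

(* Iterating the lens estimate along [u_(k+1) = u_k + l_k (s_k - u_k)], with [s_k]
   almost nearest to [u_k], makes both sequences converge. *)
Lemma near_nearest S u (e : R) : closed S -> S !=set0 -> 0 < e ->
  exists u' p, [/\ `|u' - u| <= e, S p &
    forall y, S y -> `|u' - p| <= `|u' - y|].
Proof.
move=> clS [z Sz] e0.
pose B := `|u - z|.
have B0 : 0 <= B by exact: normr_ge0.
(* The [k]-th move has length at most [c 2^-k B], so the total displacement is at most [2 c B <= e];
   [c <= 1/2] keeps every [l k] below 1. *)
pose c := Num.min 2^-1 (e / (2 * (B + 1))).
have c0 : 0 < c by rewrite lt_min invr_gt0 ltr0n /= divr_gt0 //; lra.
have c2 : c <= 2^-1 by rewrite ge_min lexx.
have cB : 2 * c * B <= e.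
  have : c <= e / (2 * (B + 1)) by rewrite ge_min lexx orbT.
  rewrite ler_pdivlMr; last by lra.
  by nra.
pose h k : R := 2^-1 ^+ k.
have h0 k : 0 < h k by rewrite exprn_gt0 // invr_gt0.
have h1 k : h k <= 1 by rewrite exprn_ile1 ?invr_ge0 // invf_le1 ?ler1n.
have hS k : h k.+1 = 2^-1 * h k by rewrite /h exprS.
pose l k := c * h k.
have l0 k : 0 < l k by rewrite mulr_gt0.
have l1 k : l k < 1 by have := h1 k; have := h0 k; rewrite /l; nra.
(* The tolerance is matched to the lens estimate: divided by [l k], it leaves the squared radius
   [h k ^+ 2]. *)
pose eps k := l k * h k ^+ 2.
have eps0 k : 0 < eps k by rewrite mulr_gt0 // exprn_gt0.
have /choice[sel hsel] : forall q : H * H * R, exists s, S q.1.2 -> 0 < q.2 ->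
    [/\ S s, `|q.1.1 - s| <= `|q.1.1 - q.1.2| &
        forall y, S y -> `|q.1.1 - s| ^+ 2 <= `|q.1.1 - y| ^+ 2 + q.2].
  case=> -[v s0] d /=; have [Ss0|nS] := pselect (S s0); last by exists s0.
  have [d0|d0] := ltP 0 d; last by exists s0.
  by have [s hs] := near_minimizer v Ss0 d0; exists s.
pose st := fix st k : H * H := if k is k'.+1 then
    let v := (st k').1 + l k' *: ((st k').2 - (st k').1) in
    (v, sel (v, (st k').2, eps k'.+1))
  else (u, sel (u, z, eps 0%N)).
pose us k := (st k).1; pose ss k := (st k).2.
have usS k : us k.+1 = us k + l k *: (ss k - us k) by [].
have Sss k : S (ss k).
  elim: k => [|k ih]; first by case: (hsel (u, z, eps 0%N) Sz (eps0 _)).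
  by case: (hsel (us k.+1, ss k, eps k.+1) ih (eps0 _)).
have minss k y : S y -> `|us k - ss k| ^+ 2 <= `|us k - y| ^+ 2 + eps k.
  case: k => [|k].
    by case: (hsel (u, z, eps 0%N) Sz (eps0 _)) => // _ _; apply.
  by case: (hsel (us k.+1, ss k, eps k.+1) (Sss k) (eps0 _)) => // _ _; apply.
have decss k : `|us k.+1 - ss k.+1| <= `|us k.+1 - ss k|.
  by case: (hsel (us k.+1, ss k, eps k.+1) (Sss k) (eps0 _)).
have ssB k : `|us k - ss k| <= B.
  elim: k => [|k ih]; first by case: (hsel (u, z, eps 0%N) Sz (eps0 _)).
  apply: (le_trans (decss k)); rewrite usS.
  rewrite (_ : _ - ss k = (1 - l k) *: (us k - ss k)); last first.
    by rewrite scalerBl scale1r -(opprB (us k)) scalerN addrAC.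
  rewrite normrZ ger0_norm; last by rewrite subr_ge0 ltW.
  by have := l0 k; have := l1 k; nra.
(* [F k] contains every later [ss n], and [F k.+1] lies within [h k] of [ss k]; so [ss] is Cauchy
   and its limit belongs to every [F k]. *)
pose F k := S `&` [set y | `|us k - y| <= `|us k - ss k|].
have lens k y : F k.+1 y -> l k * `|y - ss k| ^+ 2 <=
    `|us k - ss k| ^+ 2 - `|us k - y| ^+ 2.
  move=> [Sy Fy]; apply: lens_estimate => //; first exact/ltW.
  by rewrite -usS; apply: (le_trans Fy).
have nestF k : F k.+1 `<=` F k.
  move=> y Fy; have [Sy _] := Fy; split => //=.
  have := lens _ _ Fy; have := mulr_ge0 (ltW (l0 k)) (sqr_ge0 `|y - ss k|).
  by move=> ? ?; rewrite -ler_sqr ?nnegrE //; lra.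
have subF k n : (k <= n)%N -> F n `<=` F k.
  move=> /subnK <-; elim: (n - k)%N => [//|m ih]; rewrite addSn.
  by apply: subset_trans ih; exact: nestF.
have Fss k : F k (ss k) by split => /=.
have diamF k y : F k.+1 y -> `|y - ss k| <= h k.
  move=> Fy; have := lens _ _ Fy; have := minss k y Fy.1 => h2 h3.
  rewrite -ler_sqr ?nnegrE // ?(ltW (h0 k)) //.
  rewrite -(ler_pM2l (l0 k)); apply: (le_trans h3).
  by move: h2; rewrite /eps; lra.
have cvh : h @ \oo --> (0 : R).
  by apply: cvg_expr; rewrite ger0_norm ?invr_ge0 // invf_lt1 // ltr1n.
have cvss : cvgn ss.
  apply: (@cvgn_of_tail_bound _ h) => // m n.
  rewrite leq_eqVlt => /predU1P[<-|mn]; first by rewrite subrr normr0 ltW.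
  by apply: diamF; apply: subF mn _ _.
have usmn m n : (m <= n)%N -> `|us n - us m| <= 2 * c * B * (h m - h n).
  move=> /subnK <-; elim: (n - m)%N => [|k ih].
    by rewrite add0n !subrr normr0 mulr0.
  rewrite addSn usS addrAC; apply: (le_trans (ler_normD _ _)).
  have : `|l (k + m)%N *: (ss (k + m)%N - us (k + m)%N)| <= c * h (k + m)%N * B.
    rewrite normrZ gtr0_norm // distrC ler_wpM2l //; exact: ltW.
  by move=> h2; move: ih; rewrite hS; move: h2; lra.
have cvus : cvgn us.
  apply: (@cvgn_of_tail_bound _ (fun m => 2 * c * B * h m)).
    rewrite -[X in _ --> X](mulr0 (2 * c * B)); apply: cvgM => //.
    exact: cvg_cst.
  move=> m n mn; apply: (le_trans (usmn _ _ mn)); rewrite ler_wpM2l //.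
    by rewrite !mulr_ge0 // ltW.
  by rewrite gerBl ltW.
pose p := limn ss; pose u' := limn us.
have Fp k : F k p.
  have clF : closed (F k).
    apply: closedI => //.
    apply: (@closed_comp _ _ (fun y : H => `|us k - y|)
             [set r | r <= `|us k - ss k|]); last exact: closed_le.
    by move=> y _; apply: cvg_norm; apply: cvgB => //; exact: cvg_cst.
  apply: (closed_cvg (F k) clF _ _ cvss).
  by exists k => // m /= km; apply: (subF k m km).
have cv1 y : `|us k - y| ^+ 2 @[k --> \oo] --> `|u' - y| ^+ 2.
  under eq_fun do rewrite expr2; rewrite expr2.
  by apply: cvgM; apply: cvg_norm; apply: cvgB => //; exact: cvg_cst.
have cveps : eps @ \oo --> (0 : R).
  have -> : (0 : R) = c * 0 * 0 ^+ 2 by rewrite mulr0 mul0r.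
  apply: cvgM; first by apply: cvgM => //; exact: cvg_cst.
  by under eq_fun do rewrite expr2; rewrite expr2; apply: cvgM.
exists u', p; split.
- have : `|us k - u| @[k --> \oo] --> `|u' - u|.
    by apply: cvg_norm; apply: cvgB => //; exact: cvg_cst.
  move=> cv; apply: (ler_cvg_to cv (cvg_cst e)).
  exists 0%N => // k _ /=; have := usmn 0%N k (leq0n k).
  move=> /le_trans; apply; apply: le_trans cB.
  rewrite ler_piMr ?mulr_ge0 // ?ltW //; have := h0 k; have := h1 0%N; lra.
- by case: (Fp 0%N).
- move=> y Sy; rewrite -ler_sqr ?nnegrE //.
  have := cvgD (cv1 y) cveps; rewrite addr0 => /(_ _) cv2.
  apply: (ler_cvg_to (cv1 p) cv2).
  exists 0%N => // k _ /=; apply: le_trans (minss k y Sy).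
  by rewrite ler_sqr ?nnegrE //; case: (Fp k).
Qed.

End Nearest.

(** * Normals to a prox-regular set *)

Section ClarkeProximal.
Context (R : realType) (H : completeNormedModType R).
Context (dot : {dot H for (@idfun R)}) (Hdot : norm_of_dot dot).
Implicit Types (S K : set H) (x y u v w h : H).

Lemma half_inve_ge0 (r : \bar R) : (0 < r)%E -> 0 <= half_inve r.
Proof.
case: r => [r| |] //=; rewrite lte_fin => r0.
by rewrite invr_ge0 mulr_ge0 // ltW.
Qed.

Lemma closed_dot_le u (c : R) : closed [set w | dot u w <= c].
Proof.
apply: (@closed_comp _ _ (dot u) [set r | r <= c]); last exact: closed_le.
by move=> w _; apply: cvg_dotr.
Qed.

Lemma prox_regular_le r S x v : prox_regular dot r S -> S x ->
  proximal_normal_cone dot S x v ->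
  forall y, S y -> dot v (y - x) <= half_inve r * `|v| * `|y - x| ^+ 2.
Proof.
move=> [_ Sr] Sx vx y Sy.
have [->|v0] := eqVneq v 0; first by rewrite dot0l normr0 mulr0 mul0r.
have pv : 0 < `|v| by rewrite normr_gt0.
have := Sr x v Sx vx v0 y Sy; rewrite dotZl ler_pdivrMl //.
by rewrite mulrA (mulrC `|v|).
Qed.

Lemma proximal_normal_nearest S u p (a : R) : 0 <= a -> S p ->
  (forall y, S y -> `|u - p| <= `|u - y|) ->
  proximal_normal_cone dot S p (a *: (u - p)).
Proof.
move=> a0 Sp pmin; split => //; exists (a / 2), 1; split => //.
  by rewrite divr_ge0.
move=> y Sy _; have : `|u - p| ^+ 2 <= `|u - y| ^+ 2.
  by rewrite lerXn2r ?nnegrE // pmin.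
rewrite (_ : u - y = (u - p) - (y - p)); last by rewrite opprB addrA subrK.
move: (u - p) (y - p) => b c; rewrite (sqr_normB Hdot) dotZl => bc.
have {}bc : dot b c <= `|c| ^+ 2 / 2 by lra.
by rewrite mulrAC -mulrA ler_wpM2l.
Qed.

(* With [p_n] a nearest point to some [u_n] close to [xs n + ts n *: h], the
   proximal normals [v n = (u_n - p_n) / ts n] satisfy
   [|v n|^2 <= dot h (v n) + O(ts n)]. If they did not tend to 0, a point common
   to the sets [A m] would be a proximal normal [w] at [x] with [dot w h > 0]. *)
Lemma polar_proximal_tangent r S x h : (0 < r)%E -> prox_regular dot r S ->
  S x -> (forall v, proximal_normal_cone dot S x v -> dot v h <= 0) ->
  clarke_tangent_cone S x h.
Proof.
move=> r0 Sr Sx polh xs ts Sxs xsx ts0 tscv.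
have clS : closed S by case: Sr.
(* With the tolerance [ts n ^+ 2], the error [e n] still vanishes after division by [ts n]. *)
have /choice[q hq] : forall n, exists q : H * H,
    [/\ `|q.1 - (xs n + ts n *: h)| <= ts n ^+ 2, S q.2 &
      forall y, S y -> `|q.1 - q.2| <= `|q.1 - y|].
  move=> n; have e0 : 0 < ts n ^+ 2 by rewrite exprn_gt0.
  have S0 : S !=set0 by exists x.
  have [u [p ?]] := near_nearest Hdot (xs n + ts n *: h) clS S0 e0.
  by exists (u, p).
pose us n := (q n).1; pose ps n := (q n).2.
pose e n := (ts n)^-1 *: (us n - (xs n + ts n *: h)).
pose v n := (ts n)^-1 *: (us n - ps n).
have tn0 n : ts n != 0 by rewrite gt_eqF.
have en n : `|e n| <= ts n.
  rewrite normrZ gtr0_norm ?invr_gt0 // ler_pdivrMl // -expr2.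
  by case: (hq n).
have usE n : us n - xs n = ts n *: (h + e n).
  rewrite scalerDr scalerA divff // scale1r opprD.
  by rewrite addrCA (addrCA (_ *: _)) subrr addr0.
have psE n : ps n - xs n = ts n *: (h + e n - v n).
  rewrite scalerBr -usE scalerA divff // scale1r.
  by rewrite opprB [RHS]addrC addrA subrK.
exists (fun n => h + e n - v n); split; last first.
  by move=> n; rewrite -psE addrC subrK; case: (hq n).
have cvts : ts @ \oo --> (0 : R) by [].
have cve : e @ \oo --> (0 : H).
  apply/norm_cvg0P; apply: (squeeze_cvgr _ (cvg_cst 0) cvts).
  by apply: nearW => n; rewrite normr_ge0 en.
suff cvv : v @ \oo --> (0 : H).
  rewrite -[X in _ --> X](_ : h + 0 - 0 = h); last by rewrite addr0 subr0.
  by apply: cvgB => //; apply: cvgD => //; exact: cvg_cst.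
have [B B0 tsB] : exists2 B, 0 < B & forall n, `|ts n| <= B.
  have [B [_ hB]] := cvg_seq_bounded (cvgP _ cvts).
  exists (`|B| + 1); first by rewrite ltr_wpDl.
  move=> n; apply: (hB _ _ n) => //.
  by rewrite (le_lt_trans (ler_norm _)) // ltrDl.
have {}tsB n : ts n <= B by rewrite (le_trans (ler_norm _)).
pose M := `|h| + B; have M0 : 0 <= M by rewrite addr_ge0 // ltW.
have vM n : `|v n| <= M.
  rewrite normrZ gtr0_norm ?invr_gt0 // ler_pdivrMl //.
  have [_ _ /(_ _ (Sxs n))/le_trans] := hq n; apply.
  rewrite -/(us n) usE normrZ gtr0_norm // ler_pM2l //.
  by rewrite (le_trans (ler_normD _ _)) // lerD2l (le_trans (en n)).
have rho0 := half_inve_ge0 r0.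
have vN n y : S y ->
    dot (v n) (y - ps n) <= half_inve r * M * `|y - ps n| ^+ 2.
  move=> Sy; have [_ Sps psmin] := hq n.
  have ti : 0 <= (ts n)^-1 by rewrite invr_ge0 ltW.
  have nv := proximal_normal_nearest ti Sps psmin.
  apply: (le_trans (prox_regular_le Sr Sps nv Sy)).
  by rewrite ler_wpM2r ?sqr_ge0 //; apply: ler_wpM2l => //; exact: vM.
set rho := half_inve r in rho0 vN.
have psxs n : `|ps n - xs n| <= 2 * M * ts n.
  rewrite psE normrZ gtr0_norm // mulrC ler_pM2r //.
  rewrite (le_trans (ler_normB _ _)) // (_ : 2 * M = M + M); last by ring.
  rewrite lerD // (le_trans (ler_normD _ _)) // lerD2l.
  by rewrite (le_trans (en n)).
have psx : ps @ \oo --> x.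
  rewrite -[ps](_ : (fun n => (ps n - xs n) + xs n) = ps); last first.
    by apply/funext => n; rewrite subrK.
  rewrite -[x]add0r; apply: cvgD => //; apply: norm_cvg0.
  apply: (squeeze_cvgr _ (cvg_cst 0) (_ : 2 * M * ts n @[n --> \oo] --> 0)).
    by apply: nearW => n; rewrite normr_ge0 psxs.
  by rewrite -[X in _ --> X](mulr0 (2 * M)); apply: cvgM => //; exact: cvg_cst.
pose c := M + rho * M * (2 * M) ^+ 2.
(* The normal [v n] at [ps n] is tested against [xs n]. Since
   [xs n - ps n = - ts n (h + e n - v n)], dividing by [ts n] isolates [|v n|^2]. *)
have vh n : `|v n| ^+ 2 <= dot h (v n) + c * ts n.
  have := vN n _ (Sxs n).
  rewrite -opprB psE dotNr dotZr normrN normrZ gtr0_norm // exprMn.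
  have : dot (v n) (e n) <= M * ts n.
    apply: (le_trans (dot_le_norm Hdot _ _)).
    by apply: ler_pM.
  have : `|h + e n - v n| ^+ 2 <= (2 * M) ^+ 2.
    rewrite lerXn2r ?nnegrE //; first by rewrite mulr_ge0.
    have := psxs n; rewrite psE normrZ gtr0_norm // mulrC ler_pM2r //.
  rewrite !dotDr dotNr -Hdot (dotC h).
  move: (`|v n| ^+ 2) (dot (v n) h) (dot (v n) (e n)) => a b d.
  move: (`|h + e n - v n| ^+ 2) (ts0 n) => f; rewrite /c.
  move: (ts n) ((2 * M) ^+ 2) => t m t0 h1 h2 h3.
  have h4 : rho * M * f <= rho * M * m by rewrite ler_wpM2l // mulr_ge0.
  rewrite -(ler_pM2l t0); nra.
have dvh (d : R) : 0 < d -> \forall n \near \oo, dot h (v n) < d.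
  move=> d0; apply: contrapT => nd.
  have hn N : exists2 n, (N <= n)%N & d <= dot h (v n).
    apply: contrapT => hN; apply: nd; exists N => // n /= Nn.
    by rewrite ltNge; apply/negP => dn; apply: hN; exists n.
  (* Conditions met by [v n] once [|x - ps n|] is below [1 / (m + 1)] and [dot h (v n) >= d]: the
     last one is the normal inequality at [ps n] rewritten with base point [x]. In the limit over
     [m] it says that a common point is a proximal normal at [x]. All conditions are of the form
     [dot u w <= a] or a norm bound, hence closed and convex. *)
  pose A m := [set w | `|w| <= M] `&` [set w | dot (- h) w <= - d] `&`
    \bigcap_(y in S) [set w | dot (y - x) w <=
       rho * M * (`|y - x| + m.+1%:R^-1) ^+ 2 + M * m.+1%:R^-1].
  have [||||| w Aw] := @nested_convex_meet _ _ _ Hdot A M.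
  - move=> m; apply: closedI; first apply: closedI.
    + apply: (@closed_comp _ _ (fun w : H => `|w|) [set s | s <= M]).
        by move=> w _; exact: norm_continuous.
      exact: closed_le.
    + exact: closed_dot_le.
    + by apply: closed_bigI => y _; exact: closed_dot_le.
  - move=> m; have mid (u w1 w2 : H) (a : R) : dot u w1 <= a -> dot u w2 <= a ->
        dot u (2^-1 *: (w1 + w2)) <= a.
      by move=> u1 u2; rewrite dotZr dotDr ler_pdivrMl //; lra.
    move=> w1 w2 [[/= n1 d1] y1] [[/= n2 d2] y2]; split; first split.
    + rewrite /= normrZ ger0_norm ?invr_ge0 // ler_pdivrMl //.
      by apply: (le_trans (ler_normD _ _)); lra.
    + exact: mid.
    + by move=> y Sy /=; apply: mid; [exact: y1|exact: y2].
  - move=> m; have m0 : 0 < m.+1%:R^-1 :> R by rewrite invr_gt0.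
    have [N _ hN] : \forall n \near \oo, `|x - ps n| < m.+1%:R^-1.
      by move/cvgrPdist_lt: psx; apply.
    have [n Nn dn] := hn N; exists (v n); split; first split => /=.
    + exact: vM.
    + by rewrite dotNl lerN2.
    + move=> y Sy /=; rewrite dotC.
      have xn : `|x - ps n| <= m.+1%:R^-1 by apply: ltW; exact: hN.
      have yps : `|y - ps n| <= `|y - x| + m.+1%:R^-1.
        rewrite (_ : y - ps n = (y - x) + (x - ps n)); last first.
          by rewrite addrA subrK.
        by rewrite (le_trans (ler_normD _ _)) // lerD2l.
      have -> : dot (v n) (y - x) =
          dot (v n) (y - ps n) + dot (v n) (- (x - ps n)).
        by rewrite -dotDr opprB addrA subrK.
      rewrite lerD //.
        apply: (le_trans (vN n y Sy)); rewrite ler_wpM2l ?mulr_ge0 //.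
        by rewrite lerXn2r ?nnegrE // ?addr_ge0.
      apply: (le_trans (dot_le_norm Hdot _ _)); rewrite normrN.
      by apply: ler_pM => //; exact: vM.
  - move=> m w [[n1 d1] y1]; split; first by split.
    move=> y Sy /=; apply: (le_trans (y1 y Sy)).
    have le12 : m.+2%:R^-1 <= m.+1%:R^-1 :> R by rewrite lef_pV2 ?posrE // ler_nat.
    rewrite lerD // ?ler_wpM2l // ?mulr_ge0 // lerXn2r ?nnegrE ?addr_ge0 //.
    by rewrite lerD2l.
  - by move=> w [[]].
  have nw : proximal_normal_cone dot S x w.
    split => //; exists (rho * M), 1; split => //; first exact: mulr_ge0.
    move=> y Sy _; rewrite dotC.
    have cv : rho * M * (`|y - x| + m.+1%:R^-1) ^+ 2 + M * m.+1%:R^-1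
        @[m --> \oo] --> rho * M * (`|y - x| + 0) ^+ 2 + M * 0.
      apply: cvgD; apply: cvgM; try exact: cvg_cst; last exact: cvg_harmonic.
      under eq_fun do rewrite expr2; rewrite expr2.
      by apply: cvgM; (apply: cvgD; [exact: cvg_cst|exact: cvg_harmonic]).
    rewrite addr0 mulr0 addr0 in cv.
    apply: (ler_cvg_to (cvg_cst _) cv); apply: nearW => m.
    by have [_ /(_ y Sy)] := Aw m.
  have := polh w nw; have [[_ /=]] := Aw 0%N; rewrite dotNl dotC.
  lra.
apply/norm_cvg0P/cvgrPdist_lt => d d0.
have cvct : c * ts n @[n --> \oo] --> 0.
  by rewrite -[X in _ --> X](mulr0 c); apply: cvgM => //; exact: cvg_cst.
have d2 : 0 < d ^+ 2 / 2 by rewrite divr_gt0 // exprn_gt0.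
move/cvgrPdist_lt: cvct => /(_ _ d2) cvct.
near=> n.
have h1 : dot h (v n) < d ^+ 2 / 2 by near: n; exact: dvh.
have h2 : `|0 - c * ts n| < d ^+ 2 / 2 by near: n.
rewrite sub0r normrN normr_id -ltr_sqr ?nnegrE ?(ltW d0) //.
apply: (le_lt_trans (vh n)); move: h2; rewrite sub0r normrN.
by have := ler_norm (c * ts n); lra.
Unshelve. all: by end_near.
Qed.

(* The proximal normal cone [K] is closed and convex, and [v] minus its projection
   on [K] is a Clarke tangent vector, hence 0. *)
Lemma clarke_normal_le r S x v : (0 < r)%E -> prox_regular dot r S ->
  clarke_normal_cone dot S x v ->
  forall y, S y -> dot v (y - x) <= half_inve r * `|v| * `|y - x| ^+ 2.
Proof.
move=> r0 Sr [Sx vT].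
have rho0 := half_inve_ge0 r0.
(* The global inequality with its explicit constant is used in place of [proximal_normal_cone],
   whose free [sigma] and [delta] do not pass to limits; by prox-regularity both describe the same
   cone. *)
pose K := [set w | forall y, S y ->
  dot w (y - x) <= half_inve r * `|w| * `|y - x| ^+ 2].
suff : K v by [].
have NK w : proximal_normal_cone dot S x w -> K w.
  by move=> Nw y Sy; exact: (prox_regular_le Sr Sx Nw).
have KZ a w : 0 <= a -> K w -> K (a *: w).
  move=> a0 Kw y Sy; rewrite dotZl normrZ ger0_norm //.
  by rewrite (mulrCA _ a) -mulrA; apply: ler_wpM2l => //; exact: Kw.
have K0 : K 0 by move=> y _; rewrite dot0l normr0 mulr0 mul0r.
(* Adding the inequalities gives the constant [|w1| + |w2|]; prox-regularity, through [NK], improves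
   it to [|w1 + w2|]. *)
have KD w1 w2 : K w1 -> K w2 -> K (w1 + w2).
  move=> K1 K2; apply: NK; split => //.
  exists (half_inve r * `|w1| + half_inve r * `|w2|), 1; split => //.
    by apply: addr_ge0; exact: mulr_ge0.
  by move=> y Sy _; rewrite dotDl mulrDl; apply: lerD; [exact: K1|exact: K2].
have clK : closed K.
  rewrite (_ : K = \bigcap_(y in S) [set w |
      dot (y - x) w - half_inve r * `|y - x| ^+ 2 * `|w| <= 0]); last first.
    apply/seteqP; split => w Kw y Sy /=; have := Kw y Sy => /=;
      by rewrite subr_le0 dotC mulrAC.
  apply: closed_bigI => y Sy.
  apply: (@closed_comp _ _
    (fun w => dot (y - x) w - half_inve r * `|y - x| ^+ 2 * `|w|)
    [set s | s <= 0]); last exact: closed_le.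
  move=> w _; apply: cvgB; first exact: cvg_dotr.
  by apply: cvgM; [exact: cvg_cst|exact: norm_continuous].
have [p [Kp vp0 vpK]] := cone_projection Hdot v clK K0 KD KZ.
have /vT : clarke_tangent_cone S x (v - p).
  by apply: (@polar_proximal_tangent r) => // w /NK Kw; rewrite dotC vpK.
rewrite (_ : dot v (v - p) = `|v - p| ^+ 2).
  by rewrite exprn_even_le0 //= normr_eq0 subr_eq0 => /eqP ->.
by rewrite Hdot dotDl dotNl (dotC p) vp0 subr0.
Qed.
End ClarkeProximal.

(** * Growth of absolutely continuous functions *)

Section Variation.
Context (R : realType) (V : normedModType R).
Implicit Types (F : R -> V) (U : set R) (p q s t : R).

(** Disjoint unordered intervals, as in [abs_continuous]. Their restriction to [U] allows two uses:
    [U] is a small open cover of a null set in [abs_continuous_growth], and the whole line in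
    [gronwall_variation]. *)
Definition subdivision U p t n (u v : 'I_n -> R) : Prop :=
  (forall i, [/\ p <= u i, u i <= v i, v i <= t & `[u i, v i] `<=` U]) /\
  trivIset [set: 'I_n] (fun i => `]u i, v i[%classic).

Definition variation_sums F U p t : set R :=
  [set x | exists n (u v : 'I_n -> R), subdivision U p t u v /\
     x = \sum_(i < n) `|F (v i) - F (u i)|].

Definition variation F U p t : R := sup (variation_sums F U p t).

Lemma variation_sums0 F U p t : variation_sums F U p t 0.
Proof.
exists 0%N, (fun=> 0), (fun=> 0); rewrite big_ord0; split => //.
by split=> [[]|[]].
Qed.

Lemma variation_sums_extend F U p s t x : p <= s -> s <= t -> `[s, t] `<=` U ->
  variation_sums F U p s x -> variation_sums F U p t (x + `|F t - F s|).
Proof.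
move=> ps st stU [n [u [v [[uv tuv] ->]]]].
pose ext (w : 'I_n -> R) z (i : 'I_n.+1) :=
  if unlift ord_max i is Some j then w j else z.
have extw w z j : ext w z (widen_ord (leqnSn n) j) = w j.
  rewrite /ext (_ : widen_ord _ j = lift ord_max j) ?liftK //.
  by apply/val_inj; rewrite /= /bump leqNgt ltn_ord.
have extm w z : ext w z ord_max = z by rewrite /ext unlift_none.
exists n.+1, (ext u s), (ext v t); split; last first.
  rewrite big_ord_recr /= !extm; congr (_ + _).
  by apply: eq_bigr => i _; rewrite !extw.
split=> [i|i j _ _].
  rewrite /ext; case: unliftP => [j|] _ //.
  by have [pu uvj vs UU] := uv j; split => //; exact: le_trans st.
rewrite /ext; case: unliftP => [i'|] ->; case: unliftP => [j'|] -> //.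
- by move=> ij; congr lift; exact: tuv.
- move=> [z [/=]]; rewrite !in_itv /= => /andP[_ zv] /andP[sz _].
  have [_ _ vs _] := uv i'.
  by have := lt_le_trans (lt_trans sz zv) vs; rewrite ltxx.
- move=> [z [/=]]; rewrite !in_itv /= => /andP[sz _] /andP[_ zv].
  have [_ _ vs _] := uv j'.
  by have := lt_le_trans (lt_trans sz zv) vs; rewrite ltxx.
Qed.

Lemma variation_sums_sub F U p s t : s <= t ->
  variation_sums F U p s `<=` variation_sums F U p t.
Proof.
move=> st _ [n [u [v [[uv tuv] ->]]]]; exists n, u, v; split => //; split => // i.
by have [? ? ? ?] := uv i; split => //; exact: le_trans st.
Qed.

Lemma variation_le F U p t (c : R) :
  (forall x, variation_sums F U p t x -> x <= c) -> variation F U p t <= c.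
Proof. by move=> h; apply: ge_sup => //; exists 0; exact: variation_sums0. Qed.

Lemma le_variation F U p t x : has_ubound (variation_sums F U p t) ->
  variation_sums F U p t x -> x <= variation F U p t.
Proof. by move=> ub Px; apply: ub_le_sup. Qed.

Lemma variation_extend F U p s t : has_ubound (variation_sums F U p t) ->
  p <= s -> s <= t -> `[s, t] `<=` U ->
  variation F U p s + `|F t - F s| <= variation F U p t.
Proof.
move=> ub ps st stU; rewrite -lerBrDr; apply: variation_le => x Px.
by rewrite lerBrDr; apply: le_variation => //; exact: variation_sums_extend.
Qed.

Lemma variation_mono F U p s t : has_ubound (variation_sums F U p t) ->
  s <= t -> variation F U p s <= variation F U p t.
Proof.
move=> ub st; apply: variation_le => x Px.
by apply: le_variation => //; exact: variation_sums_sub Px.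
Qed.

Lemma subdivision_length U (W : set R) p t n (u v : 'I_n -> R) :
  measurable W -> `[p, t] `&` U `<=` W -> subdivision U p t u v ->
  ((\sum_(i < n) (v i - u i))%:E <= lebesgue_measure W)%E.
Proof.
move=> mW UW [uv tuv].
have -> : (\sum_(i < n) (v i - u i))%:E =
    (\sum_(i < n) lebesgue_measure `]u i, v i[%classic)%E.
  rewrite -sumEFin; apply: eq_bigr => i _; have [_ uvi _ _] := uv i.
  rewrite lebesgue_measure_itv /= lte_fin; case: ltP => // vu.
  have -> : v i = u i by apply/le_anti; rewrite vu uvi.
  by rewrite subrr.
rewrite -measure_semi_additive_ord //; last exact: bigsetU_measurable.
apply: le_measure; rewrite ?inE //; first exact: bigsetU_measurable.
elim/big_ind : _ => [//|A B hA hB z [/hA|/hB] //|i _ z].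
rewrite /= in_itv /= => /andP[uz zv]; apply: UW.
have [pu _ vt UU] := uv i; split; rewrite /= ?in_itv /=.
  by rewrite (le_trans pu) ?ltW // (lt_le_trans zv).
by apply: UU; rewrite /= in_itv /= !ltW.
Qed.

(** A single pair [d], [e] is assumed, so that [W] can be chosen after [d]. *)
Lemma abs_continuous_variation a b F (d e : R) U (W : set R) p t :
  (forall (n : nat) (u v : 'I_n -> R),
      (forall i, [/\ a <= u i, u i <= v i & v i <= b]) ->
      trivIset [set: 'I_n] (fun i => `]u i, v i[%classic) ->
      \sum_(i < n) (v i - u i) < d -> \sum_(i < n) `|F (v i) - F (u i)| < e) ->
  a <= p -> t <= b -> measurable W -> `[p, t] `&` U `<=` W ->
  (lebesgue_measure W < d%:E)%E ->
  forall x, variation_sums F U p t x -> x <= e.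
Proof.
move=> ac ap tb mW UW Wd _ [n [u [v [suv ->]]]]; apply/ltW/ac.
- move=> i; have [pu uv vt _] := suv.1 i.
  by split; rewrite ?(le_trans ap) ?(le_trans vt).
- exact: suv.2.
- by rewrite -lte_fin; apply: le_lt_trans Wd; exact: subdivision_length suv.
Qed.

End Variation.

(** * Comparison of increments outside a null set *)

Section Creeping.
Context (R : realType).
Implicit Types (F G : R -> R) (p q s t : R).

(* Descending from [q]: the points from which the estimate reaches [q] form a
   set closed under decreasing limits, since [G] is nondecreasing. *)
Lemma creeping F G p q : p <= q ->
  (forall t, p <= t <= q -> forall e, 0 < e -> exists2 d, 0 < d &
    forall s, p <= s <= q -> `|s - t| < d -> `|F s - F t| < e) ->
  (forall s t, p <= s -> s <= t -> t <= q -> G s <= G t) ->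
  (forall t, p < t <= q ->
     exists s, [/\ p <= s, s < t & F t - F s <= G t - G s]) ->
  F q - F p <= G q - G p.
Proof.
move=> pq cF mG step.
pose A := [set t | [/\ p <= t, t <= q & F q - F t <= G q - G t]].
have Aq : A q by split; rewrite ?subrr.
have iA : has_inf A by split; [exists q|exists p => t []].
set r := inf A.
have pr : p <= r by apply: lb_le_inf; [exists q|move=> t []].
have rq : r <= q by apply: ge_inf; [exact: iA.2|].
have Ar : A r.
  split => //; apply/ler_addgt0Pr => e e0.
  have prq : p <= r <= q by rewrite pr.
  have [d d0 hd] := cF r prq e e0.
  have [t [pt tq At] trd] := inf_adherent d0 iA.
  have rt : r <= t by apply: ge_inf; [exact: iA.2|].
  have ptq : p <= t <= q by rewrite pt.
  have trd' : `|t - r| < d by rewrite ger0_norm ?subr_ge0 // ltrBlDl.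
  have := hd t ptq trd'; rewrite ltr_distl => /andP[_ h].
  have := mG r t pr rt tq; rewrite -/r in h *; lra.
have [-> //|pr'] := eqVneq p r; first by case: Ar.
have ltpr : p < r by rewrite lt_neqAle pr' pr.
have prq : p < r <= q by rewrite ltpr.
have [s [ps sr h]] := step r prq.
have [_ _ Ar'] := Ar.
have As : A s by split => //; [exact: le_trans (ltW sr) rq|lra].
have : r <= s by apply: ge_inf; [exact: iA.2|].
by rewrite leNgt sr.
Qed.

Lemma abs_continuous_unif (W : normedModType R) (a b : R) (x : R -> W) :
  abs_continuous a b x -> forall e : R, 0 < e -> exists2 d : R, 0 < d &
    forall s t, a <= s -> s <= t -> t <= b -> t - s < d -> `|x t - x s| < e.
Proof.
move=> ac e e0; have [d d0 hd] := ac e e0; exists d => // s t as_ st tb std.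
have := hd 1%N (fun=> s) (fun=> t); rewrite !big_ord1; apply => //.
by move=> i j _ _ _; rewrite !ord1.
Qed.

Lemma abs_continuous_le (W : normedModType R) (a b : R) (x y : R -> W) F :
  abs_continuous a b x -> abs_continuous a b y ->
  (forall s t, a <= s -> s <= t -> t <= b ->
     `|F t - F s| <= `|x t - x s| + `|y t - y s|) ->
  abs_continuous a b (F : R -> R^o).
Proof.
move=> acx acy h e e0.
have e2 : 0 < e / 2 by rewrite divr_gt0.
have [d1 d10 h1] := acx _ e2; have [d2 d20 h2] := acy _ e2.
exists (Num.min d1 d2) => [|n u v uv tuv]; first by rewrite lt_min d10.
rewrite lt_min => /andP[l1 l2].
rewrite (splitr e).
apply: le_lt_trans (ltrD (h1 n u v uv tuv l1) (h2 n u v uv tuv l2)).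
rewrite -big_split /=; apply: ler_sum => i _; have [? ? ?] := uv i; exact: h.
Qed.

(** Nothing is known of [F] at the points of [N], but these lie in an open set [U] of measure below
    [d], inside which the total variation of [F] is at most [e]. Adding this variation to [G] pays
    for the steps taken at such points. *)
Lemma abs_continuous_growth (a b : R) F G (N : set R) p q :
  abs_continuous a b (F : R -> R^o) -> a <= p -> p <= q -> q <= b ->
  (@lebesgue_measure R).-negligible N ->
  (forall s t, p <= s -> s <= t -> t <= q -> G s <= G t) ->
  (forall t, p < t < q -> ~ N t -> forall e, 0 < e ->
     exists s, [/\ p <= s, s < t & F t - F s <= G t - G s + e * (t - s)]) ->
  F q - F p <= G q - G p.
Proof.
move=> acF ap pq qb negN mG step.
(* [creeping] starts its descent at [q], where no estimate is assumed; [q] joins the exceptional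
   set. *)
have {N negN step} [N negN step] :
  exists2 N, (@lebesgue_measure R).-negligible N &
  (forall t, p < t <= q -> ~ N t -> forall e, 0 < e ->
     exists s, [/\ p <= s, s < t & F t - F s <= G t - G s + e * (t - s)]).
  exists (N `|` [set q]).
    apply: negligibleU => //; exists [set q]; split => //.
    exact: lebesgue_measure_set1.
  move=> t /andP[pt]; rewrite le_eqVlt => /predU1P[->|tq] Nt e e0.
    by exfalso; apply: Nt; right.
  by apply: step => //; [rewrite pt|move=> Nt'; apply: Nt; left].
suff h e : 0 < e -> F q - F p <= G q - G p + e * (q - p + 1).
  apply/ler_addgt0Pr => e e0; have qp1 : 0 < q - p + 1 by lra.
  have := h (e / (q - p + 1)); rewrite divfK ?gt_eqF //; apply.
  by rewrite divr_gt0.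
move=> e0; have [d d0 hd] := acF e e0.
have [M [mM M0 NM]] := negN.
have [U [oU MU]] : exists U, [/\ open U, M `<=` U &
    (lebesgue_measure U < d%:E)%E].
  have Moo : (lebesgue_measure M < +oo)%E by rewrite M0.
  have [U [oU MU hU]] := lebesgue_regularity_outer mM Moo d0.
  exists U; split => //; apply: le_lt_trans hU.
  have mU : measurable U by exact: open_measurable.
  have h : (lebesgue_measure U <=
      lebesgue_measure M + lebesgue_measure (U `\` M))%E.
    rewrite -[X in (lebesgue_measure X <= _)%E](setDUK MU).
    exact: measureU2 mM (measurableD mU mM).
  apply: (le_trans h).
  by rewrite [X in (X + _)%E](M0 : lebesgue_measure M = 0%E) add0e.
move=> Ud.
have mU : measurable U by exact: open_measurable.
have ubU t : t <= q -> forall x, variation_sums (F : R -> R^o) U p t x -> x <= e.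
  move=> tq; apply: (abs_continuous_variation hd ap _ mU) => //.
  exact: le_trans qb.
have hubU t : t <= q -> has_ubound (variation_sums (F : R -> R^o) U p t).
  by move=> tq; exists e => x; exact: ubU.
(* The term [e * t] absorbs the error off [N], the variation absorbs the increments near [N];
   together they add at most [e * (q - p + 1)]. *)
pose G' t := G t + e * t + variation (F : R -> R^o) U p t.
suff : F q - F p <= G' q - G' p.
  have := ubU q (lexx q) => ub1.
  have := variation_le ub1.
  have : 0 <= variation (F : R -> R^o) U p p.
    by apply: le_variation; [exact: hubU|exact: variation_sums0].
  by rewrite /G'; lra.
have mV s t : s <= t -> t <= q ->
    variation (F : R -> R^o) U p s <= variation (F : R -> R^o) U p t.
  by move=> st tq; apply: variation_mono => //; exact: hubU.
apply: creeping => //.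
- move=> t /andP[pt tq] c c0.
  have [d' d'0 hd'] := abs_continuous_unif acF c0; exists d' => // s /andP[ps sq].
  rewrite ltr_distl => /andP[s1 s2]; have [st|ts] := leP s t.
    rewrite distrC; apply: hd' => //; [exact: le_trans ps|exact: le_trans qb|].
    by rewrite ltrBlDr addrC -ltrBlDr.
  apply: hd'; [exact: le_trans pt|exact: ltW|exact: le_trans qb|].
  by rewrite ltrBlDl.
- move=> s t ps st tq; rewrite /G'.
  by have := mV s t st tq; have := mG s t ps st tq; nra.
- move=> t /andP[pt tq].
  have [Nt|Nt] := pselect (N t); last first.
    have ptq : p < t <= q by rewrite pt.
    have [s [ps st h]] := step t ptq Nt e e0.
    by exists s; split => //; rewrite /G'; have := mV s t (ltW st) tq; nra.
  have /nbhs_ballP[c /= c0 hc] : nbhs t U.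
    by apply: open_nbhs_nbhs; split => //; exact/MU/NM.
  pose s := Num.max p (t - c / 2).
  have ps : p <= s by rewrite le_max lexx.
  have st : s < t by rewrite gt_max pt ltrBlDr ltrDl divr_gt0.
  have stU : `[s, t] `<=` U.
    move=> z /=; rewrite in_itv /= => /andP[sz zt]; apply: hc.
    rewrite /ball /= ger0_norm ?subr_ge0 //.
    have : t - c / 2 <= s by rewrite le_max lexx orbT.
    lra.
  exists s; split => //.
  have := variation_extend (hubU t tq) ps (ltW st) stU.
  have := mG s t ps (ltW st) tq.
  have : F t - F s <= `|F t - F s| by exact: ler_norm.
  have : e * s <= e * t by rewrite ler_wpM2l // ltW.
  by rewrite /G'; lra.
Qed.

End Creeping.

(** * Lebesgue measurable functions and Bochner integrals *)

Section LowerIntegral.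
Context d (T : measurableType d) (R : realType).
Context (mu : {measure set T -> \bar R}).

(** Holds without measurability: the integral of a nonnegative function is a supremum over the
    simple functions below it. *)
Lemma le_integral_patch (D E : set T) (f g : T -> \bar R) :
  (forall x, D x -> 0 <= f x)%E -> (forall x, E x -> 0 <= g x)%E ->
  (forall x, D x -> E x /\ (f x <= g x)%E) ->
  (\int[mu]_(x in D) f x <= \int[mu]_(x in E) g x)%E.
Proof.
move=> f0 g0 fg; rewrite !ge0_integralE //; apply: le_ereal_sup.
move=> _ [h hf <-]; exists h => // x; apply: (le_trans (hf x)).
rewrite !patchE; case: ifPn => [/set_mem Dx|_].
  by have [Ex fgx] := fg x Dx; rewrite mem_set.
by case: ifPn => // /set_mem Ex; exact: g0.
Qed.

(** Each set where [f > q], [q] rational, is a measurable set [B] up to a negligible one. The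
    supremum of the functions [q 1_B] is measurable, lies below [f] on [D], which makes it
    integrable, and reaches [f] off countably many negligible sets. *)
Lemma completed_measurable_representative (D : set T) (f : T -> R) :
  L1fun_ge0 mu D f ->
  exists h : T -> R, [/\ measurable_fun setT h, forall x, 0 <= h x,
    mu.-integrable setT (EFin \o h) & {ae mu, forall x, D x -> f x <= h x}].
Proof.
move=> [[mf intf] f0].
(* An enumeration of the nonnegative rationals; codes of negative rationals and invalid codes give
   0. *)
pose q n : R :=
  Num.max 0 (if (unpickle n : option rat) is Some r then ratr r else 0).
have q0 n : 0 <= q n by rewrite le_max lexx.
have /choice[B hB] : forall n, exists BN : set T * set T,
    [/\ measurable BN.1, mu.-negligible BN.2 &
     BN.1 `|` BN.2 = D `&` f @^-1` [set r | q n < r]].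
  move=> n; have [A mA [N nN AN]] := mf _ (@open_gt _ (q n)).
  by exists (A, N).
pose u x n : \bar R := (q n * \1_((B n).1) x)%:E.
pose h x := esups (u x) 0%N.
have hE x : h x = ereal_sup (range (u x)).
  rewrite /h /esups /sdrop; congr ereal_sup; apply/seteqP.
  by split => _ [n _ <-]; exists n.
have u0 x n : (0 <= u x n)%E by rewrite lee_fin mulr_ge0.
have hge x n : (u x n <= h x)%E by rewrite hE; apply: ereal_sup_ubound; exists n.
have uB x n : (B n).1 x -> u x n = (q n)%:E.
  by move=> Bx; rewrite /u indicE mem_set // mulr1.
have BD x n : (B n).1 x -> D x /\ q n < f x.
  by have [_ _ BN] := hB n => Bx; have : ((B n).1 `|` (B n).2) x by [left];
    rewrite BN.
have hf x : D x -> (h x <= (f x)%:E)%E.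
  move=> Dx; rewrite hE; apply: ge_ereal_sup => _ [n _ <-].
  rewrite lee_fin indicE; have [/set_mem Bx|_] := boolP (_ \in _).
    by rewrite mulr1 ltW //; exact: (BD _ _ Bx).2.
  by rewrite mulr0 f0.
have hD x : ~ D x -> h x = 0%E.
  move=> Dx; apply/le_anti; rewrite (le_trans (u0 x 0%N) (hge x 0%N)) andbT.
  rewrite hE; apply: ge_ereal_sup => _ [n _ <-].
  rewrite /u indicE memNset ?mulr0 // => Bx.
  by have [] := BD _ _ Bx.
have h0 x : (0 <= h x)%E by exact: le_trans (hge x 0%N).
have hfin x : h x \is a fin_num.
  rewrite ge0_fin_numE //; have [Dx|Dx] := pselect (D x).
    by apply: le_lt_trans (hf x Dx) _; rewrite ltry.
  by rewrite hD.
have mh : measurable_fun setT h.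
  apply: measurable_fun_esups => n; apply/measurable_EFinP.
  apply: measurable_funM => //; apply: measurable_indic.
  by have [] := hB n.
exists (fine \o h); split.
- exact: measurableT_comp.
- by move=> x; rewrite fine_ge0.
- apply/integrableP; split.
    by apply/measurable_EFinP; exact: measurableT_comp.
  apply: le_lt_trans intf.
  rewrite (_ : (\int[mu]_x _ = \int[mu]_(x in D) (`|h x|))%E).
    apply: le_integral_patch => // x Dx; split => //.
    by rewrite gee0_abs // (le_trans (hf _ Dx)) // lee_fin ler_norm.
  rewrite [RHS]integral_mkcond; apply: eq_integral => x _ /=.
  rewrite patchE; case: ifPn => [_|/negP Dx].
    by rewrite -[in RHS](fineK (hfin x)).
  by rewrite hD ?normr0 // => Dx'; apply: Dx; rewrite mem_set.
- have : {ae mu, forall x n, ~ (B n).2 x}.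
    apply/ae_foralln => n; have [_ nB _] := hB n.
    by apply: negligibleS nB => x /= /contrapT.
  apply: filterS => x Nx Dx /=.
  rewrite leNgt; apply/negP => hfx.
  have [r] := rat_in_itvoo hfx; rewrite in_itv /= => /andP[hr rf].
  pose n := pickle r.
  have qn : q n = ratr r.
    rewrite /q pickleK; apply/max_idPr; rewrite (le_trans _ (ltW hr)) //.
    by rewrite fine_ge0.
  have Bx : (B n).1 x.
    have [_ _ BN] := hB n.
    have : ((B n).1 `|` (B n).2) x by rewrite BN; split => //=; rewrite qn.
    by move=> [//|/Nx].
  have := hge x n; rewrite uB // qn -(fineK (hfin x)) lee_fin.
  by rewrite leNgt hr.
Qed.

End LowerIntegral.

(** * Sections of integrable functions on a product *)

Section Sections.
Context d1 d2 (T1 : measurableType d1) (T2 : measurableType d2) (R : realType).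
Context (m1 : {sigma_finite_measure set T1 -> \bar R}).
Context (m2 : {sigma_finite_measure set T2 -> \bar R}).

Lemma ae_sections (P : T1 * T2 -> Prop) :
  {ae (m1 \x m2)%E, forall z, P z} ->
  {ae m1, forall x, {ae m2, forall y, P (x, y)}}.
Proof.
move=> [A [mA A0 PA]].
have mx : measurable_fun setT (m2 \o xsection A) by exact: measurable_fun_xsection.
have : ae_eq m1 setT (m2 \o xsection A) (cst 0%E).
  apply/ae_eq_integral_abs => //.
  rewrite -[RHS]A0 /= /product_measure1; apply: eq_integral => x _.
  by rewrite gee0_abs.
apply: filterS => x /(_ Logic.I) /= Ax0.
exists (xsection A x); split => //; first exact: measurable_xsection.
by move=> y /= nP; rewrite /xsection /= inE; exact: PA.
Qed.

(** Tonelli for a measurable majorant [h] of [g]: [G] is the partial integral of [h]. For [g] on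
    [Qdelta] it yields an integrable bound in [t] for the integral over [s]. *)
Lemma section_representative (D : set (T1 * T2)) (g : T1 * T2 -> R) :
  L1fun_ge0 (m1 \x m2)%E D g ->
  exists G : T1 -> R, [/\ measurable_fun setT G, forall x, 0 <= G x,
    m1.-integrable setT (EFin \o G) &
    {ae m1, forall x, exists h : T2 -> R,
      [/\ forall y, 0 <= h y, m2.-integrable setT (EFin \o h),
        \int[m2]_y h y = G x &
        {ae m2, forall y, D (x, y) -> g (x, y) <= h y}]}].
Proof.
move=> /completed_measurable_representative[h [mh h0 ih gh]].
pose F x := (\int[m2]_y (h (x, y))%:E)%E.
have mEh : measurable_fun setT (EFin \o h) by apply/measurable_EFinP.
have h0' z : (0 <= (EFin \o h) z)%E by rewrite lee_fin.
have mF : measurable_fun setT F by exact: (measurable_fun_fubini_tonelli_F _ mEh).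
have F0 x : (0 <= F x)%E by apply: integral_ge0 => y _; rewrite lee_fin.
have iF : m1.-integrable setT F.
  apply/integrableP; split => //.
  have /integrableP[_] := ih; apply: le_lt_trans.
  rewrite (_ : (\int[m1]_x `|F x|)%E = (\int[m1 \x m2]_z (EFin \o h) z)%E).
    by apply: le_integral_patch => // z _; split => //; exact: lee_abs.
  rewrite (fubini_tonelli1 _ mEh h0'); apply: eq_integral => x _.
  by rewrite gee0_abs.
have Ffin : {ae m1, forall x, F x \is a fin_num}.
  by have := integrable_ae measurableT iF; apply: filterS => x; apply.
(* [fine] sends infinite values to 0; they occur only on a negligible set, by [Ffin]. *)
exists (fine \o F); split.
- exact: measurableT_comp.
- by move=> x; rewrite fine_ge0.
- apply/integrableP; split.
    by apply/measurable_EFinP; exact: measurableT_comp.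
  have /integrableP[_] := iF; apply: le_lt_trans.
  apply: le_integral_patch => // x _; split => //=.
  case: (F x) (F0 x) => [r| |] //=; by rewrite ?normr0 leey.
- apply: filterS2 Ffin (ae_sections gh) => x Fx ghx.
  have mhx : measurable_fun setT (fun y => h (x, y)).
    exact: measurableT_comp mh (pair1_measurable x).
  exists (fun y => h (x, y)); split => //.
  apply/integrableP; split; first exact/measurable_EFinP.
  rewrite (_ : (\int[m2]_y _ = F x)%E); first by rewrite -ge0_fin_numE.
  by apply: eq_integral => y _; rewrite gee0_abs ?lee_fin.
Qed.

End Sections.

(** * Bochner integrals paired with vectors *)

Section Bochner.
Context d (T : measurableType d) (R : realType).
Context (mu : {measure set T -> \bar R}).
Context (H : completeNormedModType R).
Context (dot : {dot H for (@idfun R)}) (Hdot : norm_of_dot dot).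
Implicit Types (D : set T) (f : T -> H) (w e : H).

Lemma ae_eq_integrable D (p k : T -> \bar R) : measurable D ->
  measurable_fun D k -> ae_eq mu D p k ->
  mu.-integrable D p -> mu.-integrable D k.
Proof.
move=> mD mk pk /integrableP[mp ip]; apply/integrableP; split => //.
rewrite -(@ae_eq_integral _ _ _ mu D (abse \o k) (abse \o p)) //.
- exact: measurableT_comp.
- exact: measurableT_comp.
- by apply: filterS pk => x pkx Dx /=; rewrite pkx.
Qed.

Lemma ae_le_Rintegral D (p k : T -> R) : measurable D ->
  mu.-integrable D (EFin \o p) -> mu.-integrable D (EFin \o k) ->
  {ae mu, forall x, D x -> p x <= k x} ->
  \int[mu]_(x in D) p x <= \int[mu]_(x in D) k x.
Proof.
move=> mD ip ik pk.
(* [m] equals [p] almost everywhere and is below [k] everywhere. *)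
pose m x := Num.min (p x) (k x).
have mm : measurable_fun D (EFin \o m).
  apply/measurable_EFinP; apply: measurable_minr; apply/measurable_EFinP.
    exact: measurable_int ip.
  exact: measurable_int ik.
have pm : ae_eq mu D (EFin \o p) (EFin \o m).
  by apply: filterS pk => x pkx Dx /=; rewrite /m min_l // pkx.
have im : mu.-integrable D (EFin \o m).
  exact: (ae_eq_integrable mD mm pm ip).
rewrite (_ : \int[mu]_(x in D) p x = \int[mu]_(x in D) m x).
  by apply: le_Rintegral => // x _; rewrite /m ge_min lexx orbT.
rewrite /Rintegral; congr fine; apply: ae_eq_integral => //.
exact: measurable_int ip.
Qed.

Section FiniteDomain.
Context (D : set T) (mD : measurable D) (Doo : (mu D < +oo)%E).

Lemma simple_dot_integral (s : {fimfun T >-> H}) e : integrable_simple mu D s ->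
  mu.-integrable D (fun x => (dot e (s x))%:E) /\
  (\int[mu]_(x in D) (dot e (s x))%:E = (dot e (simple_integral mu D s))%:E)%E.
Proof.
move=> hs; pose A y := D `&` s @^-1` [set y].
have mA y : measurable (A y) by have [] := hs y.
(* [integrable_simple] leaves the fibre over 0 unbounded in measure; the finiteness of [mu D] covers
   it. *)
have Afin y : mu (A y) \is a fin_num.
  rewrite ge0_fin_numE //; apply: le_lt_trans Doo.
  by apply: le_measure; rewrite ?inE //; exact: subIsetl.
have AD y : A y `&` D = A y by rewrite /A setIAC setIid.
pose r : seq H := finmap.enum_fset (fset_set (range s)).
have ur : uniq r by exact: finmap.fset_uniq.
have fr : finite_set (range s) by exact: fimfunP.
have iA y : mu.-integrable D (fun x => ((\1_(A y) x)%:E : \bar R)).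
  apply/integrableP; split; first exact/measurable_EFinP/measurable_indic.
  under eq_integral do rewrite gee0_abs ?lee_fin //.
  by rewrite integral_indic // AD -ge0_fin_numE.
have sum_dot x : D x -> ((dot e (s x))%:E =
    \sum_(y <- r) ((dot e y)%:E * (\1_(A y) x)%:E)%E)%E.
  move=> Dx; have sr : s x \in r.
    by rewrite [_ \in _](in_fset_set fr) inE; exists x.
  rewrite (bigD1_seq (s x)) //= indicE mem_set // mule1.
  rewrite big1_seq ?adde0 // => y /andP[ysx _].
  rewrite indicE memNset ?mule0 // => -[_ /= sxy].
  by rewrite sxy eqxx in ysx.
split.
  apply: (eq_integrable mD
    (fun x => \sum_(y <- r) ((dot e y)%:E * (\1_(A y) x)%:E)%E)%E).
    by move=> x /set_mem Dx; rewrite sum_dot.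
  by apply: integrable_sum => // y _; exact: integrableZl.
rewrite (eq_integral
    (fun x => \sum_(y <- r) ((dot e y)%:E * (\1_(A y) x)%:E)%E)%E).
  rewrite integral_sum //; last by move=> y; exact: integrableZl.
  rewrite /simple_integral -(fsbig_widen (range s)) //; last first.
    move=> y [_ /= ys]; rewrite (_ : D `&` _ = set0) ?measure0 ?scale0r //.
    by apply/seteqP; split => // x [Dx /= sxy]; apply: ys; exists x.
  rewrite fsbig_finite //= (big_morph _ (fun u v => dotDr u v e) (dot0r e)).
  rewrite -sumEFin; apply: eq_bigr => y _.
  rewrite integralZl // integral_indic // AD.
  by rewrite dotZr EFinM muleC (fineK (Afin y)).
by move=> x /set_mem Dx; rewrite sum_dot.
Qed.

(* [f] need not be Borel measurable, and [|f - s n|] tends to 0 in lower integral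
   only, which is not subadditive; pairing with [e] restores measurability. The
   bound [|e| <= 1] avoids scaling that lower integral. *)
Lemma bochner_dot f w e : `|e| <= 1 -> is_bochner_integral mu D f w ->
  exists p : T -> R, [/\ mu.-integrable D (EFin \o p),
    {ae mu, forall x, D x -> p x = dot e (f x)} &
    \int[mu]_(x in D) p x = dot e w].
Proof.
move=> e1 [s [ss [Z [mZ Z0 sZ]] sf sw]].
have cvZ x : D x -> ~ Z x -> s n x @[n --> \oo] --> f x.
  by move=> Dx Zx; apply: contrapT => ns; apply: Zx; apply: sZ => /= /(_ Dx).
pose g n x := dot e (s n x).
(* Cutting off the null set [Z] makes [h n] converge to [p] at every point of [D], so that [p] is
   measurable. *)
pose h n x := \1_(~` Z) x * g n x.
pose p x := \1_(~` Z) x * dot e (f x).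
have ig n : mu.-integrable D (EFin \o g n).
  by have [] := simple_dot_integral e (ss n).
have mh n : measurable_fun D (h n).
  apply: measurable_funM; first by apply: measurable_indic; exact: measurableC.
  by apply/measurable_EFinP; exact: measurable_int (ig n).
have aeZ : {ae mu, forall x, ~ Z x} by exists Z; split => // x /= /contrapT.
have gh n : ae_eq mu D (EFin \o g n) (EFin \o h n).
  apply: filterS aeZ => x Zx Dx /=.
  by rewrite /h indicE mem_set // mul1r.
have ih n : mu.-integrable D (EFin \o h n).
  by apply: (ae_eq_integrable mD _ (gh n) (ig n)); exact/measurable_EFinP.
have mp : measurable_fun D p.
  apply: (measurable_fun_cvg mh) => x Dx.
  rewrite /h /p indicE; have [/set_mem Zx|_] := boolP (x \in ~` Z).
    apply: cvgM; first exact: cvg_cst.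
    exact: (@cvg_dotr _ _ _ Hdot e _ _ _ (cvZ x Dx Zx)).
  by rewrite mul0r; under eq_fun do rewrite mul0r; exact: cvg_cst.
have le n x : D x -> `|p x - h n x| <= `|f x - s n x|.
  move=> Dx; rewrite /p /h -mulrBr /g -dotNr -dotDr normrM.
  have h1 : `|dot e (f x - s n x)| <= `|f x - s n x|.
    by apply: (le_trans (normr_dot_le Hdot _ _)); rewrite ler_piMl.
  apply: le_trans h1; rewrite ler_piMl // indicE.
  by case: (_ \in _); rewrite ?normr1 ?normr0.
have leint n : (\int[mu]_(x in D) `|(p x - h n x)%:E| <=
    \int[mu]_(x in D) (`|f x - s n x|%:E))%E.
  apply: le_integral_patch => // x Dx; split => //; by rewrite lee_fin le.
have mpe : measurable_fun D (EFin \o p) by exact/measurable_EFinP.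
have small (c : R) : 0 < c -> \forall n \near \oo,
    (\int[mu]_(x in D) `|(p x - h n x)%:E| < c%:E)%E.
  move=> c0; move/fine_cvgP: sf => [fin /cvgrPdist_lt /(_ c c0) lt_c].
  apply: filterS2 fin lt_c => n fn; rewrite sub0r normrN => ltc.
  apply: (le_lt_trans (leint n)); rewrite -(fineK fn) lte_fin.
  exact: le_lt_trans (ler_norm _) ltc.
have iph n : (\int[mu]_(x in D) `|(p x - h n x)%:E| < +oo)%E ->
    mu.-integrable D (EFin \o (p \- h n)).
  move=> foo; apply/integrableP; split => //.
  by apply/measurable_EFinP; apply: measurable_funB.
have ip : mu.-integrable D (EFin \o p).
  have [n _ /(_ n (leqnn n)) hn] := small 1 ltr01.
  have := integrableD mD (iph n (lt_trans hn (ltry _))) (ih n).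
  by apply: eq_integrable => // x _ /=; rewrite -EFinD subrK.
exists p; split => //.
  apply: filterS aeZ => x Zx Dx.
  by rewrite /p indicE mem_set // mul1r.
have cv1 : (\int[mu]_(x in D) h n x) @[n --> \oo] --> dot e w.
  have -> : (fun n => \int[mu]_(x in D) h n x) =
      (fun n => dot e (simple_integral mu D (s n))).
    apply/funext => n; have [_] := simple_dot_integral e (ss n).
    rewrite /Rintegral.
    rewrite -(@ae_eq_integral _ _ _ mu D (EFin \o h n) (EFin \o g n)) //;
      last 2 first.
      exact: measurable_int (ig n).
      exact/measurable_EFinP.
    by move=> ->.
  exact: (@cvg_dotr _ _ _ Hdot e _ _ _ sw).
have cv2 : (\int[mu]_(x in D) h n x) @[n --> \oo] --> \int[mu]_(x in D) p x.
  apply/cvgrPdist_lt => c c0; apply: filterS (small c c0) => n hn.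
  have iphn := iph n (lt_trans hn (ltry _)).
  rewrite -RintegralB //; apply: (le_lt_trans (le_normr_Rintegral mD iphn)).
  rewrite -lte_fin /Rintegral fineK //.
  rewrite ge0_fin_numE; first by apply: lt_trans hn _; rewrite ltry.
  exact: integral_ge0.
exact: (cvg_unique _ cv2 cv1).
Qed.

(** Pairing with the unit vector along [w - w'] turns the norm into a difference of two real
    integrals, where [f - f'] enters only through its pointwise bound. *)
Lemma bochner_dist_le f f' w w' (k : T -> R) :
  is_bochner_integral mu D f w -> is_bochner_integral mu D f' w' ->
  mu.-integrable D (EFin \o k) -> (forall x, D x -> 0 <= k x) ->
  {ae mu, forall x, D x -> `|f x - f' x| <= k x} ->
  `|w - w'| <= \int[mu]_(x in D) k x.
Proof.
move=> fw fw' ik k0 fk; have [->|w0] := eqVneq (w - w') 0.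
  by rewrite normr0; apply: Rintegral_ge0.
have pw : 0 < `|w - w'| by rewrite normr_gt0.
have e1 : `| `|w - w'|^-1 *: (w - w')| <= 1.
  by rewrite normrZ gtr0_norm ?invr_gt0 // mulVf // gt_eqF.
have [p [ip pf pint]] := bochner_dot e1 fw.
have [p' [ip' pf' pint']] := bochner_dot e1 fw'.
have <- : \int[mu]_(x in D) (p x - p' x) = `|w - w'|.
  rewrite RintegralB // pint pint' -dotNr -dotDr dotZl -Hdot.
  by rewrite expr2 mulKf // gt_eqF.
apply: ae_le_Rintegral => //.
  exact: (integrableB mD ip ip').
apply: filterS3 pf pf' fk => x pf pf' fk Dx.
rewrite pf // pf' // -dotNr -dotDr; apply: le_trans (fk Dx).
by apply: (le_trans (dot_le_norm Hdot _ _)); rewrite ler_piMl.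
Qed.

Lemma bochner_cst0 : is_bochner_integral mu D (cst 0 : T -> H) 0.
Proof.
have fib (y : H) : y != 0 -> D `&` (cst 0 : T -> H) @^-1` [set y] = set0.
  by move=> y0; apply/seteqP; split => // x [_ /= y0']; rewrite y0' eqxx in y0.
exists (fun=> cst 0); split.
- move=> _ y; have [->|y0] := eqVneq y 0; last by rewrite fib // measure0.
  by rewrite (_ : _ @^-1` _ = setT) ?setIT //; apply/seteqP; split.
- by apply: aeW => x _; exact: cvg_cst.
- under eq_fun do under eq_integral do rewrite subrr normr0.
  by rewrite integral0; exact: cvg_cst.
- rewrite /simple_integral fsbig1; first exact: cvg_cst.
  move=> y _; have [->|y0] := eqVneq y 0; first by rewrite scaler0.
  by rewrite fib // measure0 scale0r.
Qed.

Lemma bochner_norm_le f w (k : T -> R) : is_bochner_integral mu D f w ->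
  mu.-integrable D (EFin \o k) -> (forall x, D x -> 0 <= k x) ->
  {ae mu, forall x, D x -> `|f x| <= k x} ->
  `|w| <= \int[mu]_(x in D) k x.
Proof.
move=> fw ik k0 fk; rewrite -[w]subr0.
apply: (bochner_dist_le fw bochner_cst0) => //.
by apply: filterS fk => x fk Dx; rewrite subr0 fk.
Qed.

End FiniteDomain.
End Bochner.

(** * A Gronwall lemma driven by a function of bounded variation *)

Section Gronwall.
Context (R : realType).
Notation leb := (@lebesgue_measure R).

Lemma derivable_approx (V : normedModType R) (f : R -> V) (t : R) :
  derivable f t 1 -> forall e : R, 0 < e -> exists2 d : R, 0 < d &
    forall s, `|s - t| < d ->
      `|f s - f t - (s - t) *: 'D_1 f t| <= e * `|s - t|.
Proof.
move=> ft e e0; have := ft; rewrite /derivable => /cvgrPdist_lt /(_ _ e0).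
rewrite near_withinE => /nbhs_ballP[d /= d0 hd]; exists d => // s sd.
have [->|st] := eqVneq s t.
  by rewrite !subrr scale0r subr0 !normr0 mulr0.
have st0 : s - t != 0 by rewrite subr_eq0.
have := hd (s - t); rewrite /ball /= sub0r normrN => /(_ sd st0).
rewrite -/('D_1 f t) scaler1 subrK => h.
rewrite -[f s - f t](scalerKV st0) -scalerBr normrZ mulrC ler_pM2r ?normr_gt0 //.
by rewrite distrC ltW.
Qed.

(** [K] is the primitive of [k], and the last clause is Lebesgue differentiation. It trades the
    value [k t] for increments of a nondecreasing function, the form in which
    [abs_continuous_growth] accepts a bound. *)
Lemma integral_left_approx (k : R -> R) : leb.-integrable setT (EFin \o k) ->
  (forall x, 0 <= k x) ->
  exists K : R -> R, [/\ forall s t, s <= t -> K s <= K t,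
    forall e, 0 < e -> exists2 d, 0 < d &
      forall s t, s <= t -> t - s < d -> K t - K s <= e &
    {ae leb, forall t, forall e, 0 < e -> exists2 d, 0 < d &
      forall s, s < t -> t - s < d -> (t - s) * k t <= K t - K s + e * (t - s)}].
Proof.
move=> ik k0.
pose K t := \int[leb]_(x in `]-oo, t]) k x.
have iS (A : set R) : measurable A -> leb.-integrable A (EFin \o k).
  by move=> mA; exact: integrableS ik.
have KB s t : s <= t -> K t - K s = \int[leb]_(x in `]s, t]) k x.
  by move=> st; rewrite /K Rintegral_itvB // iS.
have Kge s t : s <= t -> 0 <= K t - K s.
  by move=> st; rewrite KB //; apply: Rintegral_ge0.
exists K; split.
- by move=> s t st; rewrite -subr_ge0 Kge.
- move=> e e0; have [d [d0 hd]] := integral_normr_continuous ik e0.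
  exists d => // s t st std; rewrite KB //; apply: ltW.
  have st_d : (leb `]s, t]%classic < d%:E)%E.
    rewrite lebesgue_measure_itv /= lte_fin.
    case: (ltP s t) => _; last by rewrite lte_fin.
    by rewrite -EFinB lte_fin.
  have := hd _ (measurable_itv _) st_d.
  by under eq_Rintegral do rewrite ger0_norm //.
- have := FTC1Ny (fun y => iS _ (measurable_itv `]-oo, y])) _.
  have : locally_integrable setT k.
    by have := integrable_locally measurableT ik; rewrite patch_setT.
  move=> lk /(_ lk); apply: (@filterS _ _ (ae_filter_ringOfSetsType leb)).
  move=> t [dK Kt] e e0.
  have [d d0 hd] := derivable_approx dK e0; exists d => // s st std.
  have := hd s; rewrite distrC gtr0_norm ?subr_gt0 // => /(_ std).
  rewrite -derive1E -/K Kt ler_norml => /andP[_ +].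
  rewrite /GRing.scale /= -/(K s) -/(K t). lra.
Qed.


Lemma abs_continuous_within (V : normedModType R) (a b : R) (x : R -> V) :
  abs_continuous a b x -> {within `[a, b], continuous x}.
Proof.
move=> ac; apply/subspace_continuousP => t /=; rewrite in_itv /= => /andP[at_ tb].
apply/cvgrPdist_lt => e e0; rewrite near_withinE.
have [d d0 hd] := abs_continuous_unif ac e0.
apply/nbhs_ballP; exists d => //= s.
rewrite /ball /= in_itv /= => std /andP[as_ sb].
have [st|ts] := leP s t.
  by apply: hd => //; rewrite ger0_norm ?subr_ge0 in std.
rewrite distrC; apply: hd => //; first exact: ltW.
by rewrite distrC gtr0_norm ?subr_gt0 in std.
Qed.

(* On an interval [p, q] so short that [c] times the variation of [ups] and the
   integral of [k] are both at most 1/4, the maximum [m] of [F] on [T0, q]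
   satisfies [m <= max_[T0, p] F] or [m <= F p + m / 2]. *)
Lemma gronwall_variation (T0 T : R) (ups k : R -> R) (c : R) : T0 <= T ->
  abs_continuous T0 T (ups : R -> R^o) -> 0 <= c ->
  leb.-integrable setT (EFin \o k) -> (forall t, 0 <= k t) ->
  exists2 K : R, 0 <= K & forall F : R -> R,
    abs_continuous T0 T (F : R -> R^o) -> (forall t, 0 <= F t) ->
    {ae leb, forall t, T0 < t < T -> forall m,
      (forall s, T0 <= s <= t -> F s <= m) -> forall e, 0 < e ->
      exists2 d, 0 < d & forall s, T0 <= s -> s < t -> t - s < d ->
        F t - F s <= m * (c * `|ups t - ups s| + (t - s) * k t) + e * (t - s)} ->
    forall t, T0 <= t <= T -> F t <= K * F T0.
Proof.
move=> T0T acu c0 ik k0.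
have c1 : 0 < 4 * (c + 1) by lra.
(* Bounds [c] times the variation by 1/4; [c + 1] keeps the fraction defined when [c = 0]. *)
have [d1 d10 hd1] := acu (4 * (c + 1))^-1 (ltac:(by rewrite invr_gt0)).
have [L [Lmono Lsmall aeL]] := integral_left_approx ik k0.
have [d2 d20 hd2] := Lsmall 4^-1 (ltac:(by rewrite invr_gt0)).
have dmin0 : 0 < Num.min d1 d2 by rewrite lt_min d10.
pose d := Num.min d1 d2 / 2.
have d0 : 0 < d by rewrite divr_gt0.
have dd1 : d < d1.
  have : Num.min d1 d2 <= d1 by rewrite ge_min lexx.
  by rewrite /d; lra.
have dd2 : d < d2.
  have : Num.min d1 d2 <= d2 by rewrite ge_min lexx orbT.
  by rewrite /d; lra.
have [N hN] : exists N : nat, T - T0 < N%:R * d.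
  exists (Num.bound ((T - T0) / d)); rewrite -ltr_pdivrMr //.
  by apply: archi_boundP; rewrite divr_ge0 // ?subr_ge0 // ltW.
exists (2 ^+ N); first by rewrite exprn_ge0.
move=> F acF F0 aeF.
pose tau i := Num.min T (T0 + i%:R * d).
have tauT i : tau i <= T by rewrite ge_min lexx.
have tau0 i : T0 <= tau i by rewrite le_min T0T lerDl mulr_ge0 // ltW.
have tauS i : tau i <= tau i.+1.
  rewrite le_min tauT /= ge_min lerD2l ler_pM2r // ler_nat leqnSn orbT //.
have tauSd i : tau i.+1 - tau i <= d.
  rewrite lerBlDl {2}/tau; case: (leP T (T0 + i%:R * d)) => _.
    by apply: (le_trans (tauT _)); rewrite lerDl ltW.
  by rewrite ge_min; apply/orP; right; rewrite -natr1; lra.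
suff step i t : T0 <= t <= tau i -> F t <= 2 ^+ i * F T0.
  move=> t /andP[t0 tT]; apply: step; rewrite t0 /= le_min tT /=.
  by apply: (le_trans tT); rewrite -lerBlDl ltW.
elim: i t => [|i ih] t.
  rewrite /tau mul0r addr0 => /andP[t0]; rewrite le_min => /andP[_ t1].
  by rewrite expr0 mul1r (le_anti (_ : t <= T0 <= t)) // t1.
move=> /andP[t0 tt].
set p := tau i in ih *; set q := tau i.+1 in tt.
have pq : p <= q by exact: tauS.
have T0p : T0 <= p by exact: tau0.
have qT : q <= T by exact: tauT.
have [r] : exists2 r, r \in `[T0, q] & forall s, s \in `[T0, q] -> F s <= F r.
  apply: EVT_max; first exact: le_trans pq.
  apply: continuous_subspaceW (abs_continuous_within acF).
  by apply: subset_itvl; rewrite bnd_simp.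
rewrite in_itv /= => /andP[r0 rq] rmax.
suff Fr : F r <= 2 ^+ i.+1 * F T0.
  by apply: le_trans Fr; apply: rmax; rewrite in_itv /= t0.
have Fp : F p <= 2 ^+ i * F T0 by apply: ih; rewrite T0p /=.
have i0 : 0 <= 2 ^+ i * F T0 by rewrite mulr_ge0 // exprn_ge0.
have [rp|pr] := leP r p.
  apply: (le_trans (ih r _)); first by rewrite r0.
  by rewrite exprS -mulrA; lra.
rewrite exprS -mulrA.
set m := F r in rmax *.
have m0 : 0 <= m by exact: F0.
suff : F r - F p <= m / 2 by rewrite -/m; lra.
have pqd : q - p <= d by exact: tauSd.
have pqd1 : q - p < d1 by exact: le_lt_trans dd1.
have ub z : z <= q -> forall y,
    variation_sums (ups : R -> R^o) setT p z y -> y <= (4 * (c + 1))^-1.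
  move=> zq; apply: (abs_continuous_variation hd1 T0p _ (measurable_itv `[p, q])).
  - exact: le_trans qT.
  - by move=> x [/= + _]; rewrite !in_itv /= => /andP[-> xz]; exact: le_trans zq.
  - rewrite lebesgue_measure_itv /= lte_fin.
    case: (ltP p q) => _; last by rewrite lte_fin.
    by rewrite -EFinB lte_fin.
have hub z : z <= q -> has_ubound (variation_sums (ups : R -> R^o) setT p z).
  by move=> zq; exists (4 * (c + 1))^-1 => y; exact: ub.
(* By superadditivity of the variation and differentiation of [L], the increments of [G] dominate
   the assumed bound on those of [F]. *)
pose G s := m * (c * variation (ups : R -> R^o) setT p s + L s).
have Gr : G r - G p <= m / 2.
  have h1 := variation_le (ub r rq).
  have h2 : 0 <= variation (ups : R -> R^o) setT p p.
    by apply: le_variation; [exact: hub|exact: variation_sums0].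
  have h3 : L r - L p <= 4^-1.
    by apply: hd2; [exact: ltW|lra].
  have h4 : c * variation (ups : R -> R^o) setT p r <= 4^-1.
    apply: (@le_trans _ _ (c * (4 * (c + 1))^-1)); first exact: ler_wpM2l.
    by rewrite ler_pdivrMr //; lra.
  have h5 : 0 <= c * variation (ups : R -> R^o) setT p p by exact: mulr_ge0.
  by rewrite /G -mulrBr ler_wpM2l //; lra.
apply: le_trans Gr.
have [N' negN' aeN'] : exists2 N', leb.-negligible N' & forall t, ~ N' t ->
    (forall e, 0 < e -> exists2 d, 0 < d &
      forall s, s < t -> t - s < d ->
        (t - s) * k t <= L t - L s + e * (t - s)) /\
    (T0 < t < T -> forall m,
      (forall s, T0 <= s <= t -> F s <= m) -> forall e, 0 < e ->
      exists2 d, 0 < d & forall s, T0 <= s -> s < t -> t - s < d ->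
        F t - F s <= m * (c * `|ups t - ups s| + (t - s) * k t) + e * (t - s)).
  eexists; first exact: negligibleU aeL aeF.
  by move=> u nu; split; apply: contrapT => h; apply: nu; [left|right].
apply: (abs_continuous_growth acF _ _ _ negN') => //.
- exact: ltW.
- exact: le_trans qT.
- move=> s u ps su ur; rewrite /G; apply: ler_wpM2l => //; apply: lerD.
    apply: ler_wpM2l => //; apply: variation_mono => //; apply: hub.
    exact: le_trans rq.
  exact: Lmono.
- move=> u /andP[pu ur] /aeN'[aeu1 aeu2] e e0.
  have T0uT : T0 < u < T.
    by rewrite (le_lt_trans T0p pu) (lt_le_trans ur) // (le_trans rq).
  have Fum s : T0 <= s <= u -> F s <= m.
    move=> /andP[s0 su]; apply: rmax; rewrite in_itv /= s0 /=.
    by rewrite (le_trans su) // (le_trans (ltW ur)).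
  (* This error gets multiplied by [m], which may be 0, and must stay below [e / 2]. *)
  have e2 : 0 < e / (2 * (m + 1)) by rewrite divr_gt0 //; lra.
  have e3 : 0 < e / 2 by rewrite divr_gt0.
  have [b1 b10 hb1] := aeu1 _ e2.
  have [b2 b20 hb2] := aeu2 T0uT m Fum _ e3.
  pose s := Num.max p (u - Num.min b1 b2 / 2).
  have b0 : 0 < Num.min b1 b2 by rewrite lt_min b10.
  have ps : p <= s by rewrite le_max lexx.
  have su : s < u by rewrite gt_max pu ltrBlDr ltrDl divr_gt0.
  have usb : u - s < Num.min b1 b2.
    have us : u - Num.min b1 b2 / 2 <= s by rewrite le_max lexx orbT.
    by clear - us b0; lra.
  move: usb; rewrite lt_min => /andP[us1 us2].
  exists s; split => //.
  have := hb2 s (le_trans T0p ps) su us2.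
  have := hb1 s su us1.
  have : `|ups u - ups s| <=
      variation (ups : R -> R^o) setT p u - variation (ups : R -> R^o) setT p s.
    rewrite lerBrDl; apply: variation_extend (ltW su) _ => //.
    by apply: hub; rewrite (le_trans (ltW ur)).
  rewrite /G; set A := variation _ _ _ u; set B := variation _ _ _ s.
  set W := `|_|; set z := (u - s) * k u => h1 h2 h3.
  have us0 : 0 < u - s by rewrite subr_gt0.
  apply: (le_trans h3).
  have h4 : m * (c * W + z) <= m * (c * (A - B) +
      (L u - L s + e / (2 * (m + 1)) * (u - s))).
    by apply: ler_wpM2l => //; apply: lerD => //; exact: ler_wpM2l.
  have h5 : m * (e / (2 * (m + 1)) * (u - s)) <= e / 2 * (u - s).
    by rewrite mulrA ler_pM2r // mulrA ler_pdivrMr; clear - m0 e0; lra.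
  by clear - h4 h5; lra.
Qed.

End Gronwall.

(** * Solutions of the sweeping process *)

Section Sweeping.
Context (R : realType) (H : completeNormedModType R).
Context (dot : {dot H for (@idfun R)}) (Hdot : norm_of_dot dot).
Context (T0 T : R) (T0T : T0 < T).
Notation leb := (@lebesgue_measure R).

Lemma ae_itv_dense (P : R -> Prop) :
  {ae leb, forall t, `[T0, T]%classic t -> P t} ->
  forall t d, T0 <= t <= T -> 0 < d ->
    exists s, [/\ T0 <= s <= T, `|t - s| < d & P s].
Proof.
move=> [N [mN N0 PN]] t d /andP[t0 tT] d0.
pose a := Num.max T0 (t - d); pose b := Num.min T (t + d).
have ab : a < b.
  by rewrite lt_min !gt_max T0T /=; apply/andP; split; [|apply/andP; split]; lra.
apply: contrapT => h.
have abN : `]a, b[ `<=` N.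
  move=> s /=; rewrite in_itv /= => /andP[]; rewrite gt_max lt_min.
  move=> /andP[as1 as2] /andP[sb1 sb2]; apply: PN => /= Ps; apply: h.
  exists s; split.
  - by rewrite !ltW.
  - by rewrite ltr_distlC; apply/andP; split; lra.
  - by apply: Ps; rewrite /= in_itv /= !ltW.
have : (leb `]a, b[%classic <= leb N)%E by apply: le_measure => //; rewrite ?inE.
rewrite [leRHS]N0 lebesgue_measure_itv /= lte_fin ab.
by rewrite -EFinB lee_fin subr_le0 leNgt ab.
Qed.

Context (C : R -> set H) (ups : R -> R).
Context (acu : abs_continuous T0 T (ups : R -> R^o)).
Context (hC : forall s t, T0 <= s <= T -> T0 <= t <= T ->
  C t `<=` [set y + `|ups s - ups t| *: b |
             y in C s & b in [set b : H | `|b| <= 1]]).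

(** The inclusion gives [C t (x t)] only for almost every [t]. Such times are dense, and closedness
    extends membership to all times, as testing against [x s] for arbitrary [s < t] requires. *)
Lemma moving_set_mem (x : R -> H) : (forall t, T0 <= t <= T -> closed (C t)) ->
  abs_continuous T0 T x ->
  {ae leb, forall t, `[T0, T]%classic t -> C t (x t)} ->
  forall t, T0 <= t <= T -> C t (x t).
Proof.
move=> clC acx aeC t tI; apply: (clC t tI) => B /nbhs_ballP[e /= e0 eB].
have e2 : 0 < e / 2 by rewrite divr_gt0.
have [d1 d10 hd1] := abs_continuous_unif acx e2.
have [d2 d20 hd2] := abs_continuous_unif acu e2.
have d0 : 0 < Num.min d1 d2 by rewrite lt_min d10.
have [s [sI]] := ae_itv_dense aeC tI d0.
rewrite lt_min => /andP[st1 st2] /(hC tI sI)[y Cy [b /= b1 xs]].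
exists y; split => //; apply: eB; rewrite -ball_normE /=.
have {}hd (V : normedModType R) (z : R -> V) d :
    (forall s t, T0 <= s -> s <= t -> t <= T -> t - s < d ->
       `|z t - z s| < e / 2) ->
    `|t - s| < d -> `|z t - z s| < e / 2.
  move=> hz std; have [/andP[s0 sT] /andP[t0 tT]] := (sI, tI).
  have [st|ts] := leP s t.
    by apply: hz => //; rewrite ger0_norm ?subr_ge0 in std.
  rewrite distrC; apply: hz => //; first exact: ltW.
  by rewrite distrC gtr0_norm ?subr_gt0 in std.
have h1 := hd _ _ _ hd1 st1; have h2 := hd _ _ _ hd2 st2.
have -> : x t - y = (x t - x s) + `|ups t - ups s| *: b.
  by rewrite -xs opprD addrA subrK.
rewrite (splitr e); apply: (le_lt_trans (ler_normD _ _)); apply: ltrD => //.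
apply: le_lt_trans h2; rewrite normrZ normr_id.
by rewrite ler_piMr.
Qed.

(* Tests the normal [v] at time [t] against a point of [C t] close to [x s], for
   [s < t]; [ups] need not be differentiable at [t]. *)
Lemma normal_bound (x : R -> H) (t rho : R) (u : H) : T0 < t -> t < T ->
  0 <= rho -> (forall s, T0 <= s <= T -> C s (x s)) -> derivable x t 1 ->
  let v := - 'D_1 x t - u in
  (forall y, C t y -> dot v (y - x t) <= rho * `|v| * `|y - x t| ^+ 2) ->
  forall e, 0 < e -> exists2 d, 0 < d & forall s, T0 <= s -> s < t -> t - s < d ->
    (t - s) * `|v| <= 2 * `|ups t - ups s| + (t - s) * (`|u| + e).
Proof.
move=> T0t tT rho0 Cx dx v vN e e0.
have vE : v = - 'D_1 x t - u by [].
clearbody v.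
have [v0|v0] := eqVneq v 0.
  exists 1 => // s s0 st _; rewrite v0 normr0 mulr0.
  apply: addr_ge0; first exact: mulr_ge0.
  by apply: mulr_ge0; [rewrite subr_ge0 ltW|apply: addr_ge0 => //; exact: ltW].
have pv : 0 < `|v| by rewrite normr_gt0.
have e2 : 0 < e / 2 by rewrite divr_gt0.
have [d1 d10 hd1] := derivable_approx dx e2.
(* If [D] is at most this, then [rho * (2 * D ^+ 2) <= D]: the quadratic term doubles the
   coefficient of the variation, whence the 2 of the conclusion. *)
have er : 0 < (2 * rho + 1)^-1 by rewrite invr_gt0; lra.
have [d2 d20 hd2] := abs_continuous_unif acu er.
pose M := `|'D_1 x t| + e / 2.
have M0 : 0 <= M by rewrite addr_ge0 // ltW.
have m0 : 0 < 4 * rho * M ^+ 2 + 1 by rewrite ltr_wpDl // !mulr_ge0 // sqr_ge0.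
(* For [h < d3], the quadratic term [rho * (2 * (M * h) ^+ 2)] is at most [e / 2 * h]. *)
pose d3 := e / (4 * rho * M ^+ 2 + 1).
have d30 : 0 < d3 by rewrite divr_gt0.
exists (Num.min d1 (Num.min d2 d3)); first by rewrite !lt_min d10 d20.
move=> s s0 st; rewrite !lt_min => /and3P[ts1 ts2 ts3].
have sI : T0 <= s <= T by rewrite s0 ltW // (lt_trans st).
have tI : T0 <= t <= T by rewrite !ltW.
have [y Cy [b /= b1 xs]] := hC tI sI (Cx s sI).
pose D := `|ups t - ups s|.
pose h := t - s; have h0 : 0 < h by rewrite subr_gt0.
have D1 : D <= (2 * rho + 1)^-1 by apply/ltW/hd2 => //; exact: ltW.
have zh : `|x s - x t + h *: 'D_1 x t| <= e / 2 * h.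
  have := hd1 s; rewrite distrC gtr0_norm // => /(_ ts1).
  by rewrite -(opprB t s) scaleNr opprK.
have z1 : `|x s - x t| <= M * h.
  rewrite -[x s - x t](addrK (h *: 'D_1 x t)) (le_trans (ler_normB _ _)) //.
  by rewrite normrZ gtr0_norm // /M; lra.
have D0 : 0 <= D by exact: normr_ge0.
have yx : y - x t = (x s - x t) - D *: b by rewrite -xs addrAC addrK.
have nDb : `|D *: b| <= D by rewrite normrZ ger0_norm // ler_piMr.
have y1 : `|y - x t| ^+ 2 <= 2 * (M * h) ^+ 2 + 2 * D ^+ 2.
  have h1 : `|y - x t| <= M * h + D.
    by rewrite yx (le_trans (ler_normB _ _)) // lerD.
  apply: (@le_trans _ _ ((M * h + D) ^+ 2)).
    by rewrite lerXn2r ?nnegrE // addr_ge0 // mulr_ge0 // ltW.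
  by have := sqr_ge0 (M * h - D); nra.
have vN1 := vN y Cy.
have vDb : dot v (D *: b) <= `|v| * D.
  by apply: (le_trans (dot_le_norm Hdot _ _)); rewrite ler_pM2l.
have vz : dot v (x s - x t + h *: 'D_1 x t) >= - (`|v| * (e / 2 * h)).
  rewrite lerNl -dotNr; apply: (le_trans (dot_le_norm Hdot _ _)).
  by rewrite normrN ler_pM2l.
have vu : - dot v u <= `|v| * `|u|.
  by rewrite -dotNr (le_trans (dot_le_norm Hdot _ _)) // normrN.
have vD : dot v ('D_1 x t) = - `|v| ^+ 2 - dot v u.
  have -> : 'D_1 x t = - v - u by rewrite vE opprD !opprK addrK.
  by rewrite dotDr !dotNr -Hdot.
have Q : h * `|v| ^+ 2 <= `|v| * (D + h * `|u| + e / 2 * h +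
    rho * (2 * (M * h) ^+ 2 + 2 * D ^+ 2)).
  have : rho * `|v| * `|y - x t| ^+ 2 <=
      rho * `|v| * (2 * (M * h) ^+ 2 + 2 * D ^+ 2).
    by rewrite ler_wpM2l // mulr_ge0.
  move: vN1; rewrite {1}yx dotDr dotNr => q1 q2.
  move: vz; rewrite dotDr dotZr vD => q3.
  by clear - q1 q2 q3 vDb vu h0; nra.
have {Q} Q : h * `|v| <= D + h * `|u| + e / 2 * h +
    rho * (2 * (M * h) ^+ 2 + 2 * D ^+ 2).
  by rewrite -(ler_pM2l pv) mulrCA -expr2.
have DD : rho * (2 * D ^+ 2) <= D.
  have : (2 * rho + 1) * D <= 1 by rewrite -ler_pdivlMl ?mulr1 //; lra.
  by nra.
have hh : rho * (2 * (M * h) ^+ 2) <= e / 2 * h.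
  have p1 : h * (4 * rho * M ^+ 2 + 1) <= e by rewrite -ler_pdivlMr // ltW.
  have p2 : 0 <= rho * M ^+ 2 by rewrite mulr_ge0 // sqr_ge0.
  by clear - p1 p2 h0; nra.
by rewrite -/h -/D; clear - Q DD hh; lra.
Qed.


(** [u] is the total perturbation at time [t], which is all that the pointwise estimates see of [f1]
    and [f2]. *)
Definition sweeping_at (rho : R) (x : R -> H) (t : R) (u : H) : Prop :=
  derivable x t 1 /\ forall y, C t y ->
    dot (- 'D_1 x t - u) (y - x t) <=
    rho * `|- 'D_1 x t - u| * `|y - x t| ^+ 2.

(** The derivative is [- v - u], and [normal_bound] contributes a second [|u|] through [|v|]. *)
Lemma sweeping_speed (x : R -> H) (t rho : R) (u : H) : T0 < t -> t < T ->
  0 <= rho -> (forall s, T0 <= s <= T -> C s (x s)) -> sweeping_at rho x t u ->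
  forall e, 0 < e -> exists2 d, 0 < d & forall s, T0 <= s -> s < t -> t - s < d ->
    `|x t - x s| <= 2 * `|ups t - ups s| + (t - s) * (2 * `|u| + e).
Proof.
move=> T0t tT rho0 Cx [dx vN] e e0.
have e2 : 0 < e / 2 by rewrite divr_gt0.
have [d1 d10 hd1] := derivable_approx dx e2.
have [d2 d20 hd2] := normal_bound T0t tT rho0 Cx dx vN e2.
exists (Num.min d1 d2); first by rewrite lt_min d10.
move=> s s0 st; rewrite lt_min => /andP[ts1 ts2].
have := hd2 s s0 st ts2; have := hd1 s; rewrite distrC gtr0_norm ?subr_gt0 //.
move=> /(_ ts1); rewrite -(opprB t s) scaleNr opprK.
have h0 : 0 < t - s by rewrite subr_gt0.
set h := t - s in h0 *; set v := - _ - u; move=> h1 h2.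
have -> : x t - x s = h *: 'D_1 x t - (x s - x t + h *: 'D_1 x t).
  by rewrite opprD addrCA addrN addr0 opprB.
apply: (le_trans (ler_normB _ _)); rewrite normrZ gtr0_norm //.
have : `|'D_1 x t| <= `|v| + `|u|.
  have -> : 'D_1 x t = - v - u by rewrite /v opprD !opprK addrK.
  by rewrite (le_trans (ler_normB _ _)) // normrN.
rewrite -(ler_pM2l h0); lra.
Qed.

(** The normal at [x t] is tested against [y t] and conversely. The factor 4 comes from two normals,
    each bounded by [normal_bound] with factor 2. *)
Lemma sweeping_distance (x y : R -> H) (t rho : R) (u w : H) : T0 < t -> t < T ->
  0 <= rho -> (forall s, T0 <= s <= T -> C s (x s)) ->
  (forall s, T0 <= s <= T -> C s (y s)) ->
  sweeping_at rho x t u -> sweeping_at rho y t w ->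
  forall e, 0 < e -> exists2 d, 0 < d & forall s, T0 <= s -> s < t -> t - s < d ->
    `|x t - y t| - `|x s - y s| <=
    rho * `|x t - y t| * (4 * `|ups t - ups s| + (t - s) * (`|u| + `|w|)) +
    (t - s) * `|u - w| + e * (t - s).
Proof.
move=> T0t tT rho0 Cx Cy [dx vN] [dy wN] e e0.
have tI : T0 <= t <= T by rewrite !ltW.
set z := x t - y t.
have [z0|z0] := eqVneq z 0.
  exists 1 => // s s0 st _; rewrite z0 normr0 mulr0 mul0r !add0r.
  have h0 : 0 < t - s by rewrite subr_gt0.
  apply: (@le_trans _ _ 0); first by rewrite oppr_le0.
  by rewrite addr_ge0 // mulr_ge0 // ltW.
have pz : 0 < `|z| by rewrite normr_gt0.
have e4 : 0 < e / 4 by rewrite divr_gt0.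
pose e' := e / (4 * (rho * `|z| + 1)).
have rz0 : 0 <= rho * `|z| by exact: mulr_ge0.
have e'0 : 0 < e' by rewrite divr_gt0 //; lra.
have rze : rho * `|z| * (2 * e') <= e / 2.
  rewrite /e' mulrA mulrA ler_pdivrMr; last lra.
  by nra.
have [d1 d10 hd1] := derivable_approx dx e4.
have [d2 d20 hd2] := derivable_approx dy e4.
have [d3 d30 hd3] := normal_bound T0t tT rho0 Cx dx vN e'0.
have [d4 d40 hd4] := normal_bound T0t tT rho0 Cy dy wN e'0.
exists (Num.min (Num.min d1 d2) (Num.min d3 d4)).
  by rewrite !lt_min d10 d20 d30.
move=> s s0 st; rewrite !lt_min => /andP[/andP[ts1 ts2] /andP[ts3 ts4]].
have h0 : 0 < t - s by rewrite subr_gt0.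
have := hd4 s s0 st ts4; have := hd3 s s0 st ts3.
have := hd2 s; have := hd1 s; rewrite !(distrC s) !(gtr0_norm h0).
move=> /(_ ts1) + /(_ ts2); rewrite -(opprB t s) !scaleNr !opprK.
have vz := vN _ (Cy t tI); have wz := wN _ (Cx t tI).
move: vz wz; rewrite -/z -(opprB (x t) (y t)) -/z normrN dotNr.
set v := - _ - u; set v' := - _ - w.
set h := t - s in h0 *; set D := `|ups t - ups s|.
move=> vz wz h1 h2 h3 h4.
(* Cauchy-Schwarz replaces the differentiation of the norm; the factor [|z|] is cancelled at the
   end. *)
have zz : `|z| * `|z| - `|z| * `|x s - y s| <= dot z (z - (x s - y s)).
  rewrite dotDr dotNr -Hdot -expr2 lerD2l lerN2; exact: dot_le_norm.
have zD : dot z (z - (x s - y s)) <=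
    h * dot z ('D_1 x t - 'D_1 y t) + `|z| * (e / 2 * h).
  have -> : z - (x s - y s) = h *: ('D_1 x t - 'D_1 y t) -
      ((x s - x t + h *: 'D_1 x t) - (y s - y t + h *: 'D_1 y t)).
    rewrite scalerBr /z; set p := h *: _; set q := h *: _.
    have -> : x s - x t + p - (y s - y t + q) =
        (x s - x t) - (y s - y t) + (p - q) by rewrite opprD addrACA.
    rewrite [in RHS]opprD [RHS]addrCA subrr addr0.
    by rewrite !opprB addrACA [RHS]addrACA (addrC (x t)).
  rewrite dotDr dotZr lerD2l.
  apply: (le_trans (dot_le_norm Hdot _ _)); rewrite ler_pM2l // normrN.
  by apply: (le_trans (ler_normB _ _)); lra.
have Dx : 'D_1 x t = - v - u by rewrite /v opprD !opprK addrK.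
have Dy : 'D_1 y t = - v' - w by rewrite /v' opprD !opprK addrK.
clearbody v v'.
have DD : 'D_1 x t - 'D_1 y t = - v + v' - (u - w).
  by rewrite Dx Dy opprD !opprK addrACA opprB (addrC w).
have zuw : - dot z (u - w) <= `|z| * `|u - w|.
  by rewrite -dotNr (le_trans (dot_le_norm Hdot _ _)) // normrN.
have key : dot z (- v + v') <= rho * (`|v| + `|v'|) * `|z| ^+ 2.
  by rewrite dotDr dotNr (dotC z) (dotC z); clear - vz wz; lra.
rewrite -(ler_pM2l pz) mulrBr.
apply: (le_trans zz); apply: (le_trans zD); rewrite DD dotDr dotNr.
have q1 : h * dot z (- v + v') <= rho * `|z| ^+ 2 * (h * `|v| + h * `|v'|).
  rewrite (_ : _ * (_ + _) = h * (rho * (`|v| + `|v'|) * `|z| ^+ 2)); last by ring.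
  by rewrite ler_pM2l.
have q2 : rho * `|z| ^+ 2 * (h * `|v| + h * `|v'|) <=
    rho * `|z| ^+ 2 * (4 * D + h * (`|u| + `|w| + 2 * e')).
  apply: ler_wpM2l; first by rewrite mulr_ge0 // sqr_ge0.
  by clear - h3 h4; lra.
have q3 : h * - dot z (u - w) <= h * (`|z| * `|u - w|) by rewrite ler_pM2l.
have q4 : `|z| * h * (rho * `|z| * (2 * e')) <= `|z| * h * (e / 2).
  by rewrite ler_wpM2l // mulr_ge0 // ltW.
by clear - q1 q2 q3 q4; lra.
Qed.

End Sweeping.

(** * Growth and Lipschitz bounds for the perturbation *)

Section Coefficients.
Context (R : realType) (H : completeNormedModType R).
Context (dot : {dot H for (@idfun R)}) (Hdot : norm_of_dot dot).
Context (T0 T : R) (T0T : T0 < T).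
Context (C : R -> set H) (f1 : R -> H -> H) (f2 : R -> R -> H -> H).
Notation leb := (@lebesgue_measure R).

Lemma lebesgue_itvcc_lty (s t : R) : (leb `[s, t]%classic < +oo)%E.
Proof.
rewrite lebesgue_measure_itv /=; case: ifP => _; last by rewrite ltry.
by rewrite -EFinB ltry.
Qed.

Lemma integrable_itv_cst (s t c : R) : leb.-integrable `[s, t] (EFin \o cst c).
Proof.
apply/integrableP; split; first exact/measurable_EFinP/measurable_cst.
under eq_integral do rewrite /=.
rewrite integral_cst //; apply: lte_mul_pinfty => //.
exact: lebesgue_itvcc_lty.
Qed.

Lemma Rintegral_itv_cst (s t c : R) : s <= t ->
  \int[leb]_(x in `[s, t]) c = c * (t - s).
Proof.
move=> st; rewrite Rintegral_cst //; congr (_ * _).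
have st_leb : leb `[s, t]%classic = (t - s)%:E.
  rewrite lebesgue_measure_itv /= lte_fin.
  case: (ltP s t) => ts; first by rewrite -EFinB.
  by rewrite (le_anti (_ : s <= t <= s)) ?subrr // st.
exact: (congr1 fine st_leb).
Qed.

Lemma le_Rintegral_itv (s t : R) (h : R -> R) : leb.-integrable setT (EFin \o h) ->
  (forall x, 0 <= h x) -> \int[leb]_(x in `[s, t]) h x <= \int[leb]_x h x.
Proof.
move=> ih h0; have ihs : leb.-integrable `[s, t] (EFin \o h).
  by exact: integrableS ih.
rewrite /Rintegral fine_le //; try exact: integrable_fin_num.
apply: ge0_subset_integral => //; first exact: measurable_int ih.
by move=> x _; rewrite lee_fin.
Qed.

Lemma integrable_scale (c : R) (h : R -> R) : leb.-integrable setT (EFin \o h) ->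
  leb.-integrable setT (EFin \o (fun t => c * h t)).
Proof. by move=> ih; exact: (integrableZl measurableT c ih). Qed.

Lemma integrable_add (h k : R -> R) : leb.-integrable setT (EFin \o h) ->
  leb.-integrable setT (EFin \o k) ->
  leb.-integrable setT (EFin \o (fun t => h t + k t)).
Proof. by move=> ih ik; exact: (integrableD measurableT ih ik). Qed.

(** The exceptional null set is fixed before the trajectory, so one [kappa] serves all solutions.
    Integrating [alpha t * |x s|] over [s] costs the length [T - T0]; integrating [g] gives
    [G t]. *)
Lemma coefficients_growth : hypothesis_H2 T0 T C f1 -> hypothesis_H31' T0 T C f2 ->
  exists kappa : R -> R, [/\ forall t, 0 <= kappa t,
    leb.-integrable setT (EFin \o kappa) &
    {ae leb, forall t, T0 < t < T -> forall (x : R -> H) (w : H) (m : R),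
      (forall s, T0 <= s <= T -> C s (x s)) ->
      (forall s, T0 <= s <= t -> `|x s| <= m) ->
      is_bochner_integral leb `[T0, t]%classic (fun s => f2 t s (x s)) w ->
      `|f1 t (x t) + w| <= (1 + m) * kappa t}].
Proof.
move=> [_ [b1 b1L fb1] _] [a [g [aL gL f2g]]].
have [b [mb b0 ib bb]] := completed_measurable_representative b1L.
have [al [mal al0 ial aal]] := completed_measurable_representative aL.
have [G [mG G0 iG gG]] := section_representative gL.
exists (fun t => b t + G t + (T - T0) * al t); split.
- move=> t; rewrite addr_ge0 ?addr_ge0 // mulr_ge0 // subr_ge0 ltW //.
- by apply: integrable_add; [exact: integrable_add|exact: integrable_scale].
apply: (filterS3 (ae_filter_ringOfSetsType leb) _ bb aal gG).
move=> t tb ta [h [h0 ih hG gh]] /andP[T0t tT] x w m Cx xm fw.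
have tI : `[T0, T]%classic t by rewrite /= in_itv /= !ltW.
have Cs s : T0 <= s <= T -> (\bigcup_(t in `[T0, T]%classic) C t) (x s).
  by move=> sI; exists s; [rewrite /= in_itv|exact: Cx].
have m0 : 0 <= m by apply: (le_trans _ (xm T0 _)) => //; rewrite lexx ltW.
have T0t' := ltW T0t.
have f1b : `|f1 t (x t)| <= b t * (1 + m).
  apply: (le_trans (fb1 t _ tI (Cs t _))); first by rewrite T0t' ltW.
  apply: ler_pM; [exact: b1L.2|by rewrite addr_ge0|exact: tb|].
  by rewrite lerD2l xm // lexx ltW.
have wb : `|w| <= G t + (T - T0) * al t * m.
  have ihs : leb.-integrable `[T0, t] (EFin \o h) by exact: integrableS ih.
  have hc0 : 0 <= al t * m by exact: mulr_ge0.
  apply: (@le_trans _ _ (\int[leb]_(s in `[T0, t]) (h s + cst (al t * m) s))).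
    apply: (bochner_norm_le Hdot _ (lebesgue_itvcc_lty T0 t) fw) => //.
    - exact: (integrableD _ ihs (integrable_itv_cst T0 t (al t * m))).
    - by move=> s _; rewrite addr_ge0.
    apply: (@filterS _ _ (ae_filter_ringOfSetsType leb) _ _ _ gh) => s gs /=.
    rewrite in_itv /= => /andP[s0 st].
    have sI : T0 <= s <= T by rewrite s0 (le_trans st) // ltW.
    have Qts : Qdelta T0 T (t, s) by split => //=; rewrite in_itv.
    apply: (le_trans (f2g t s _ Qts (Cs s sI))); apply: lerD; first exact: gs.
    apply: ler_pM => //; [exact: aL.2|exact: ta|by apply: xm; rewrite s0].
  rewrite RintegralD //; last exact: integrable_itv_cst.
  rewrite Rintegral_itv_cst // -hG; apply: lerD; first exact: le_Rintegral_itv.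
  by rewrite mulrC mulrA ler_wpM2r // ler_wpM2r // lerD2r ltW.
apply: (le_trans (ler_normD _ _)); apply: (le_trans (lerD f1b wb)).
have := G0 t; have : 0 <= (T - T0) * al t by rewrite mulr_ge0 // subr_ge0 ltW.
by nra.
Qed.

Lemma coefficients_lipschitz (M : R) : 0 < M ->
  hypothesis_H2 T0 T C f1 -> hypothesis_H3 T0 T C f2 ->
  exists kappa : R -> R, [/\ forall t, 0 <= kappa t,
    leb.-integrable setT (EFin \o kappa) &
    {ae leb, forall t, T0 < t < T -> forall (x y : R -> H) (w v : H) (m : R),
      (forall s, T0 <= s <= t -> `|x s| <= M) ->
      (forall s, T0 <= s <= t -> `|y s| <= M) ->
      (forall s, T0 <= s <= t -> `|x s - y s| <= m) ->
      is_bochner_integral leb `[T0, t]%classic (fun s => f2 t s (x s)) w ->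
      is_bochner_integral leb `[T0, t]%classic (fun s => f2 t s (y s)) v ->
      `|(f1 t (x t) + w) - (f1 t (y t) + v)| <= m * kappa t}].
Proof.
move=> M0 [_ _ /(_ M M0)[l1 l1L fl1]] [_ _ /(_ M M0)[l2 l2L fl2]].
have [k1 [_ k10 ik1 lk1]] := completed_measurable_representative l1L.
have [k2 [_ k20 ik2 lk2]] := completed_measurable_representative l2L.
exists (fun t => k1 t + (T - T0) * k2 t); split.
- by move=> t; rewrite addr_ge0 // mulr_ge0 // subr_ge0 ltW.
- by apply: integrable_add => //; exact: integrable_scale.
apply: (filterS2 (ae_filter_ringOfSetsType leb) _ lk1 lk2).
move=> t tk1 tk2 /andP[T0t tT] x y w v m xM yM xym fw fv.
have tI : `[T0, T]%classic t by rewrite /= in_itv /= !ltW.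
have T0t' := ltW T0t.
have tt : T0 <= t <= t by rewrite lexx T0t'.
have m0 : 0 <= m by apply: le_trans (xym t tt).
have f1b : `|f1 t (x t) - f1 t (y t)| <= k1 t * m.
  apply: (le_trans (fl1 t _ _ tI (xM t tt) (yM t tt))).
  by apply: ler_pM; [exact: l1L.2| |exact: tk1|exact: xym].
have wb : `|w - v| <= (T - T0) * k2 t * m.
  have hc0 : 0 <= k2 t * m by exact: mulr_ge0.
  apply: (@le_trans _ _ (\int[leb]_(s in `[T0, t]) (cst (k2 t * m) s))).
    apply: (bochner_dist_le Hdot _ (lebesgue_itvcc_lty T0 t) fw fv) => //.
      exact: integrable_itv_cst.
    apply: aeW => s /=; rewrite in_itv /= => /andP[s0 st].
    have Qts : Qdelta T0 T (t, s).
      by split => //=; rewrite in_itv /= s0 (le_trans st) // ltW.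
    have sI : T0 <= s <= t by rewrite s0.
    apply: (le_trans (fl2 t s _ _ Qts (xM s sI) (yM s sI))).
    by apply: ler_pM; [exact: l2L.2| |exact: tk2|exact: xym].
  rewrite Rintegral_itv_cst // mulrC mulrA ler_wpM2r // ler_wpM2r //.
  by rewrite lerD2r ltW.
rewrite opprD addrACA; apply: (le_trans (ler_normD _ _)).
by apply: (le_trans (lerD f1b wb)); rewrite mulrDr (mulrC m) lerD2l (mulrC m).
Qed.

End Coefficients.

(** * A priori bound and dependence on the initial value *)

Section Solutions.
Context (R : realType) (H : completeNormedModType R).
Context (dot : {dot H for (@idfun R)}) (Hdot : norm_of_dot dot).
Context (T0 T : R) (T0T : T0 < T).
Context (C : R -> set H) (f1 : R -> H -> H) (f2 : R -> R -> H -> H).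
Context (r : \bar R) (r0 : (0 < r)%E).
Context (Cr : forall t, T0 <= t <= T -> prox_regular dot r (C t)).
Context (ups : R -> R) (acu : abs_continuous T0 T (ups : R -> R^o)).
Context (hC : forall s t, T0 <= s <= T -> T0 <= t <= T ->
  C t `<=` [set y + `|ups s - ups t| *: b |
             y in C s & b in [set b : H | `|b| <= 1]]).
Notation leb := (@lebesgue_measure R).

Lemma sweeping_solution_at (a : H) (x : R -> H) :
  sweeping_solution dot T0 T C f1 f2 a x ->
  (forall t, T0 <= t <= T -> C t (x t)) /\
  {ae leb, forall t, T0 < t < T -> exists2 w,
    is_bochner_integral leb `[T0, t]%classic (fun s => f2 t s (x s)) w &
    sweeping_at dot C (half_inve r) x t (f1 t (x t) + w)}.
Proof.
move=> [acx _ aex].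
have clC t : T0 <= t <= T -> closed (C t) by move=> /Cr[].
split.
  apply: (moving_set_mem T0T acu hC clC acx).
  apply: (@filterS _ _ (ae_filter_ringOfSetsType leb) _ _ _ aex) => t xt tI.
  by have [_ [w _ []]] := xt tI.
apply: (@filterS _ _ (ae_filter_ringOfSetsType leb) _ _ _ aex).
move=> t xt /andP[T0t tT].
have tI : T0 <= t <= T by rewrite !ltW.
have [|dx [w fw nw]] := xt; first by rewrite /= in_itv.
exists w => //; split => // y Cy.
rewrite opprD addrA; exact: (clarke_normal_le Hdot r0 (Cr tI) nw).
Qed.

Context (H2 : hypothesis_H2 T0 T C f1) (H3 : hypothesis_H3 T0 T C f2).
Context (H31' : hypothesis_H31' T0 T C f2).

(** The Gronwall lemma is applied to [1 + |x|]: its bound [m] is at least 1, so the inhomogeneous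
    terms can be multiplied by [m]. Both factors 2 come from [sweeping_speed]. *)
Lemma sweeping_solution_bounded : exists2 K : R, 0 <= K &
  forall a x, sweeping_solution dot T0 T C f1 f2 a x ->
  forall t, T0 <= t <= T -> `|x t| <= K * (1 + `|a|).
Proof.
have [k [k0 ik kb]] := coefficients_growth Hdot T0T H2 H31'.
have k20 t : 0 <= 2 * k t by rewrite mulr_ge0.
have [K K0 hK] := gronwall_variation (ltW T0T) acu (ler0n R 2)
  (integrable_scale 2 ik) k20.
exists K => // a x sx t tI.
have [acx xa _] := sx; have [Cx aex] := sweeping_solution_at sx.
suff : 1 + `|x t| <= K * (1 + `|x T0|).
  by rewrite xa; apply: le_trans; rewrite lerDr.
apply: (hK (fun t => 1 + `|x t|)) => //.
- apply: (abs_continuous_le acx acx) => s u _ _ _.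
  rewrite opprD addrACA subrr add0r.
  by apply: (le_trans (ler_dist_dist _ _)); rewrite lerDl.
apply: (filterS2 (ae_filter_ringOfSetsType leb) _ kb aex) => {tI}.
move=> {}t kt xt tT m xm e e0; have [w fw swx] := xt tT.
have /andP[T0t tT'] := tT.
have m1 : 1 <= m by apply: le_trans (xm T0 _); rewrite ?lerDl // lexx ltW.
have [d d0 hd] := sweeping_speed Hdot acu hC T0t tT' (half_inve_ge0 r0) Cx swx e0.
exists d => // s s0 st std.
have uk : `|f1 t (x t) + w| <= m * k t.
  rewrite -[X in X * _](subrKC 1); apply: kt => // u uI.
  by rewrite lerBrDl xm.
have := hd s s0 st std; set D := `|ups t - ups s|; set U := `|_ + w| in uk *.
have D0 : 0 <= D by exact: normr_ge0.
have h0 : 0 < t - s by rewrite subr_gt0.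
have := lerB_dist (x t) (x s); set h := t - s in h0 *.
have : h * U <= h * (m * k t) by rewrite ler_pM2l.
have : D <= m * D by rewrite ler_peMl.
lra.
Qed.

Lemma sweeping_solution_lipschitz (B : R) : exists2 K : R, 0 <= K &
  forall a b x y, `|a| <= B -> `|b| <= B ->
  sweeping_solution dot T0 T C f1 f2 a x ->
  sweeping_solution dot T0 T C f1 f2 b y ->
  forall t, T0 <= t <= T -> `|x t - y t| <= K * `|a - b|.
Proof.
have [L L0 hL] := sweeping_solution_bounded.
(* [|B|] because [B] may be negative, [+ 1] to make the radius positive. *)
pose M := L * (1 + `|B|) + 1.
have M0 : 0 < M by rewrite ltr_wpDl // mulr_ge0 // addr_ge0.
have bM a x : `|a| <= B -> sweeping_solution dot T0 T C f1 f2 a x ->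
    forall t, T0 <= t <= T -> `|x t| <= M.
  move=> aB sx t tI; apply: (le_trans (hL a x sx t tI)).
  rewrite /M; apply: ler_wpDr => //; rewrite ler_wpM2l // lerD2l.
  exact: le_trans (ler_norm _).
have [k [k0 ik kb]] := coefficients_growth Hdot T0T H2 H31'.
have [l [l0 il lb]] := coefficients_lipschitz Hdot T0T M0 H2 H3.
pose rho := half_inve r; have rho0 : 0 <= rho by exact: half_inve_ge0.
(* Each of the two perturbations is at most [(1 + M) * k t]; their sum enters [sweeping_distance]
   with factor [rho]. *)
have rM0 : 0 <= 2 * rho * (1 + M) by rewrite mulr_ge0 ?mulr_ge0 // addr_ge0 // ltW.
have ikl := integrable_add (integrable_scale (2 * rho * (1 + M)) ik) il.
have kl0 t : 0 <= 2 * rho * (1 + M) * k t + l t by rewrite addr_ge0 // mulr_ge0.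
have rho40 : 0 <= 4 * rho by rewrite mulr_ge0.
have [K K0 hK] := gronwall_variation (ltW T0T) acu rho40 ikl kl0.
exists K => // a b x y aB bB sx sy t tI.
have [acx xa _] := sx; have [Cx aex] := sweeping_solution_at sx.
have [acy yb _] := sy; have [Cy aey] := sweeping_solution_at sy.
rewrite -xa -yb; apply: (hK (fun t => `|x t - y t|)) => //.
- apply: (abs_continuous_le acx acy) => s u _ _ _.
  apply: (le_trans (ler_dist_dist _ _)); rewrite opprD addrACA -opprD.
  exact: ler_normB.
have FF := ae_filter_ringOfSetsType leb.
apply: (filterS2 FF _ (@filterI _ _ FF _ _ kb lb) (@filterI _ _ FF _ _ aex aey)).
move=> {tI}.
move=> {}t [kt lt] [xt yt] tT m xym e e0.
have [w fw swx] := xt tT; have [v fv swy] := yt tT.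
have /andP[T0t tT'] := tT.
have [d d0 hd] := sweeping_distance Hdot acu hC T0t tT' rho0 Cx Cy swx swy e0.
exists d => // s s0 st std; apply: (le_trans (hd s s0 st std)).
have sub u : T0 <= u <= t -> T0 <= u <= T.
  by move=> /andP[-> ut] /=; rewrite (le_trans ut) // ltW.
have xM u : T0 <= u <= t -> `|x u| <= M by move=> /sub; exact: (bM a).
have yM u : T0 <= u <= t -> `|y u| <= M by move=> /sub; exact: (bM b).
have ux := kt tT x w M Cx xM fw; have uy := kt tT y v M Cy yM fv.
have uxy := lt tT x y w v m xM yM xym fw fv.
have zm : `|x t - y t| <= m by apply: xym; rewrite lexx ltW.
move: ux uy uxy zm.
set U := `|_ + w|; set V := `|_ + v|; set W := `|_ - (_ + v)|.
set D := `|ups t - ups s|; set Z := `|x t - y t|.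
have D0 : 0 <= D by exact: normr_ge0.
have Z0 : 0 <= Z by exact: normr_ge0.
have UV0 : 0 <= U + V by apply: addr_ge0; exact: normr_ge0.
have h0 : 0 < t - s by rewrite subr_gt0.
set h := t - s in h0 *; move=> ux uy uxy zm.
have q1 : rho * Z * (4 * D + h * (U + V)) <=
    rho * m * (4 * D + h * (2 * (1 + M) * k t)).
  apply: ler_pM.
  - exact: mulr_ge0.
  - by rewrite addr_ge0 // mulr_ge0 // ltW.
  - exact: ler_wpM2l.
  - by rewrite lerD2l ler_pM2l //; lra.
have q2 : h * W <= h * (m * l t) by rewrite ler_pM2l.
lra.
Qed.

End Solutions.

Theorem proposition4p3 (R : realType) (H : completeNormedModType R)
    (dot : {dot H for (@idfun R)}) (Hdot : norm_of_dot dot)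
    (T0 T : R) (HT : T0 < T)
    (C : R -> set H) (f1 : R -> H -> H) (f2 : R -> R -> H -> H)
    (H1 : hypothesis_H1 dot T0 T C)
    (H2 : hypothesis_H2 T0 T C f1)
    (H3 : hypothesis_H3 T0 T C f2)
    (H31' : hypothesis_H31' T0 T C f2)
    (psi : H -> R -> H)
    (Hpsi : forall a, C T0 a -> sweeping_solution dot T0 T C f1 f2 a (psi a)) :
  (forall a, C T0 a -> {within `[T0, T], continuous (psi a)}) /\
  forall D : set H, D `<=` C T0 -> bounded_set D ->
    exists2 K : R, 0 <= K &
      forall a b, D a -> D b ->
        (uniform_norm T0 T (psi a \- psi b)%R <= (K * `|a - b|)%:E)%E.
Proof.
split=> [a Ca|D DC [B [_ DB]]].
  by have [ac _ _] := Hpsi a Ca; exact: abs_continuous_within ac.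
have [[r r0 Cr] [ups acu hC]] := H1.
have Cr' t : T0 <= t <= T -> prox_regular dot r (C t).
  by move=> tI; have [] := Cr t; rewrite /= ?in_itv.
have hC' s t : T0 <= s <= T -> T0 <= t <= T ->
    C t `<=` [set y + `|ups s - ups t| *: b |
               y in C s & b in [set b : H | `|b| <= 1]].
  by move=> sI tI; apply: hC; rewrite /= in_itv.
(* [bounded_set] gives bounds strictly above [B] only, hence [B + 1]. *)
have [K K0 hK] :=
  sweeping_solution_lipschitz Hdot HT r0 Cr' acu hC' H2 H3 H31' (B + 1).
exists K => // a b Da Db.
have {}DB c : D c -> `|c| <= B + 1 by apply: DB; rewrite ltrDl.
apply: ge_ereal_sup => _ [t + <-]; rewrite lee_fin /= in_itv /= => tI.
by apply: hK => //; [exact: DB|exact: DB|apply/Hpsi/DC|apply/Hpsi/DC].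
Qed.
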